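(* Let $S=\{re^{i\theta} : r>0,\ -\frac{\pi}{4}<\theta<\frac{\pi}{4}\}$. For every $t\in S$, $$\sum_{n\in\mathbb{Z}}e^{-\pi n^2t^2}-1-\frac1t=\sum_{m\ge 0}\alpha_{2m}\Psi_{2m}(t),$$ where, for every integer $m\ge 0$, $$\alpha_{2m}=S_{4m}-\frac{2^{-4m+1}(4m)!}{(2m)!(2m)!}.$$
   Context: For an integer $m\ge 0$ and $t\in S$, $\Psi_m(t)=\sqrt2\left(\frac{t^2-1}{t^2+1}\right)^m\frac{1}{\sqrt{1+t^2}}$, with the principal square root. The Hermite polynomials $H_m$ are defined by $e^{-t^2+2xt}=\sum_{m\ge0}\frac{H_m(x)}{m!}t^m$ (equivalently $H_m(x)=(-1)^me^{x^2}\frac{d^m}{dx^m}e^{-x^2}$), and the Hermite functions are $\Phi_m(x)=H_m(\sqrt{2\pi}\,x)e^{-\pi x^2}$ for $x\in\mathbb{R}$. The constants $S_{2m}$ are $S_{2m}=\frac{2^{-2m}}{m!}\sum_{n\in\mathbb{Z}}\Phi_{2m}(n)$; in particular $S_{4m}=\frac{2^{-4m}}{(2m)!}\sum_{n\in\mathbb{Z}}\Phi_{4m}(n)$. *)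

(* Defs.v *)
From Stdlib Require Import Reals ZArith Lra.
From Coquelicot Require Import Coquelicot.

Open Scope R_scope.

Definition Cexp (z : C) : C :=
  (exp (Re z) * cos (Im z), exp (Re z) * sin (Im z)).

(* Principal square root: argument in (-PI/2, PI/2], with the negative real
   axis sent to the positive imaginary axis; see [Csqrt_sqr] and
   [Csqrt_principal]. *)
Definition Csqrt (z : C) : C :=
  (sqrt ((Cmod z + Re z) / 2),
   (if Rlt_dec (Im z) 0 then -1 else 1) * sqrt ((Cmod z - Re z) / 2)).

Lemma Csqrt_sqr (z : C) : (Csqrt z * Csqrt z)%C = z.
Proof.
destruct z as [a b]; unfold Csqrt; cbn [Re Im fst snd].
assert (Hm : Cmod (a, b) * Cmod (a, b) = a ^ 2 + b ^ 2).
{ unfold Cmod; cbn [fst snd]; apply sqrt_sqrt.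
  assert (0 <= a ^ 2) by apply pow2_ge_0.
  assert (0 <= b ^ 2) by apply pow2_ge_0. lra. }
pose proof (re_le_Cmod (a, b)) as Ha; cbn [Re fst] in Ha.
set (m := Cmod (a, b)) in *.
assert (Hp : 0 <= (m + a) / 2).
{ unfold Rabs in Ha; destruct (Rcase_abs a); lra. }
assert (Hq : 0 <= (m - a) / 2).
{ unfold Rabs in Ha; destruct (Rcase_abs a); lra. }
pose proof (sqrt_sqrt _ Hp) as Ep.
pose proof (sqrt_sqrt _ Hq) as Eq.
assert (Em : sqrt ((m + a) / 2) * sqrt ((m - a) / 2) = Rabs b / 2).
{ rewrite <- sqrt_mult by assumption.
  replace ((m + a) / 2 * ((m - a) / 2)) with (Rsqr (b / 2))
    by (unfold Rsqr; nra).
  rewrite sqrt_Rsqr_abs; unfold Rdiv.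
  rewrite Rabs_mult, (Rabs_right (/ 2)); lra. }
unfold Cmult; cbn [fst snd].
unfold Rabs in Em.
destruct (Rlt_dec b 0); destruct (Rcase_abs b); try lra;
  apply injective_projections; cbn [fst snd]; nra.
Qed.

Lemma Csqrt_principal (z : C) :
  0 < Re (Csqrt z) \/ (Re (Csqrt z) = 0 /\ 0 <= Im (Csqrt z)).
Proof.
destruct z as [a b]; unfold Csqrt; cbn [Re Im fst snd].
pose proof (sqrt_pos ((Cmod (a, b) + a) / 2)) as Hp.
pose proof (sqrt_pos ((Cmod (a, b) - a) / 2)) as Hq.
destruct (Rle_lt_or_eq_dec _ _ Hp) as [H | H]; [now left | right].
split; [now symmetry |].
destruct (Rlt_dec b 0) as [Hb | Hb]; [exfalso | lra].
assert (Hlt : Rabs a < Cmod (a, b)).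
{ unfold Cmod; cbn [fst snd].
  rewrite <- sqrt_Rsqr_abs; apply sqrt_lt_1_alt.
  unfold Rsqr; split; nra. }
assert (0 < sqrt ((Cmod (a, b) + a) / 2)).
{ apply sqrt_lt_R0; unfold Rabs in Hlt; destruct (Rcase_abs a); lra. }
lra.
Qed.

(* The open sector |arg t| < PI/4. *)
Definition sector (t : C) : Prop :=
  exists r theta : R, 0 < r /\ - (PI / 4) < theta < PI / 4 /\
    t = (RtoC r * Cexp (Ci * RtoC theta))%C.

(* A bilateral series converges when both of its halves do. *)
Definition is_Zseries {K : AbsRing} {V : NormedModule K} (f : Z -> V) (l : V)
  : Prop :=
  exists l1 l2 : V,
    is_series (fun n : nat => f (Z.of_nat n)) l1 /\
    is_series (fun n : nat => f (- Z.of_nat (S n))%Z) l2 /\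
    l = plus l1 l2.

Definition ZSeries (f : Z -> R) : R :=
  Series (fun n : nat => f (Z.of_nat n)) +
  Series (fun n : nat => f (- Z.of_nat (S n))%Z).

Definition hermite (m : nat) (x : R) : R :=
  (-1) ^ m * exp (x ^ 2) * Derive_n (fun y : R => exp (- y ^ 2)) m x.

Definition Phi (m : nat) (x : R) : R :=
  hermite m (sqrt (2 * PI) * x) * exp (- (PI * x ^ 2)).

(* [S_even m] is the constant S_{2m}. *)
Definition S_even (m : nat) : R :=
  / 2 ^ (2 * m) / INR (fact m) * ZSeries (fun n : Z => Phi (2 * m) (IZR n)).

(* [alpha_even m] is the coefficient alpha_{2m}, which involves S_{4m}. *)
Definition alpha_even (m : nat) : R :=
  S_even (2 * m) -
  2 / 2 ^ (4 * m) * INR (fact (4 * m)) /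
    (INR (fact (2 * m)) * INR (fact (2 * m))).

Definition Psi (m : nat) (t : C) : C :=
  (RtoC (sqrt 2) * ((t ^ 2 - 1) / (t ^ 2 + 1)) ^ m * (1 / Csqrt (1 + t ^ 2)))%C.

(* Main.v *)
Require Import Defs.
From Stdlib Require Import Reals ZArith Lra Lia Psatz.
From Coquelicot Require Import Coquelicot.
Open Scope R_scope.

(* Put w = (t^2 - 1) / (t^2 + 1), so that |w| < 1, t^2 = (1 + w) / (1 - w) and
   Psi_m(t) = w^m (1 - w)^(1/2).  Dividing by (1 - w)^(1/2), the theorem becomes a power series
   expansion in w.  By the generating function of the Laguerre polynomials L_m^(-1/2), that is of the
   even Hermite polynomials, (1 - w)^(-1/2) exp (- PI n^2 t^2) is the sum of (-1)^m 4^(-m) / m! *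
   Phi_(2m)(n) w^m.  Cauchy's estimate bounds these coefficients by C r^(-m) exp (- d n^2) for every
   r < 1, so the sums over n and m can be exchanged.  The functional equation of theta (t -> 1/t is
   w -> -w) kills the odd powers of w; it is obtained from Polya's finite identity for binomial
   coefficients.  Finally 1 + 1/t contributes (1 - w)^(-1/2) + (1 + w)^(-1/2), twice the even part
   of the central binomial series. *)

(** * Series in normed modules *)

(** Each Gaussian coefficient is an alternating Laguerre sum, so a bound term by term would lose the
    cancellation; what is needed is Gaussian decay in n with a constant that grows only
    geometrically in m. This forces a Cauchy estimate on circles |w| = r. It and the functional
    equation of theta rest on the same device: averaging cosines over the (2h+1)-st roots of unity
    and letting h tend to infinity, with dominated convergence ([tannery_lim]) for the limit. No
    contour integral and no Poisson summation enters. The functional equation serves only to decide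
    the parity of a power series in w. It is therefore enough to have it for real w, and in squared
    form, because the functions compared are positive. Polya's identity contains a central binomial
    coefficient; only the existence of its asymptotic constant is proved, since the functional
    equation at the fixed point x = 1 determines the value. The branch of the square root is settled
    by taking the binomial series as (1 - w)^(-1/2) and by showing that its argument, like that of
    t, lies strictly between -PI/4 and PI/4. *)

Lemma minus_plus_cancel {G : AbelianGroup} (x y : G) : plus (minus x y) y = x.
Proof. unfold minus. now rewrite <- plus_assoc, plus_opp_l, plus_zero_r. Qed.

Lemma filterlim_norm_iff {K : AbsRing} {V : NormedModule K} (u : nat -> V) (l : V) :
  filterlim u eventually (locally l) <->
  forall eps : R, 0 < eps ->
    exists N, forall n, (N <= n)%nat -> norm (minus (u n) l) < eps.
Proof.
split.
- intros H eps Heps.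
  destruct (H (fun y => norm (minus y l) < eps)) as [N HN].
  + apply locally_le_locally_norm. exists (mkposreal eps Heps). intros y Hy. exact Hy.
  + now exists N.
- intros H P HP.
  apply locally_norm_le_locally in HP. destruct HP as [eps He].
  destruct (H eps (cond_pos eps)) as [N HN].
  exists N. intros n Hn. apply He, HN, Hn.
Qed.

Lemma filterlim_unique_nat {K : AbsRing} {V : NormedModule K} (u : nat -> V) (a b : V) :
  filterlim u eventually (locally a) -> filterlim u eventually (locally b) -> a = b.
Proof. intros Ha Hb. exact (filterlim_locally_unique u a b Ha Hb). Qed.

Lemma is_series_inj {K : AbsRing} {V : NormedModule K} (a : nat -> V) (l l' : V) :
  is_series a l -> is_series a l' -> l = l'.
Proof. apply filterlim_unique_nat. Qed.

Lemma norm_lim_le {K : AbsRing} {V : NormedModule K} (u : nat -> V) (l : V) (M : R) :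
  filterlim u eventually (locally l) -> (forall n, norm (u n) <= M) -> norm l <= M.
Proof.
intros Hu HM.
apply (is_lim_seq_le (fun n => norm (u n)) (fun _ => M) (norm l) M).
- exact HM.
- apply (filterlim_comp _ _ _ u norm eventually (locally l)); [exact Hu | apply filterlim_norm].
- apply is_lim_seq_const.
Qed.

Lemma norm_sum_n_le {K : AbsRing} {V : NormedModule K} (a : nat -> V) (b : nat -> R) n :
  (forall k, (k <= n)%nat -> norm (a k) <= b k) -> norm (sum_n a n) <= sum_n b n.
Proof.
intros H. induction n as [|n IH].
- rewrite !sum_O. apply H; lia.
- rewrite !sum_Sn. eapply Rle_trans; [apply norm_triangle|].
  apply Rplus_le_compat; [apply IH; intros; apply H; lia | apply H; lia].
Qed.

Lemma is_series_norm_le {K : AbsRing} {V : NormedModule K} (a : nat -> V) (b : nat -> R)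
  (la : V) (lb : R) :
  is_series a la -> is_series b lb -> (forall n, norm (a n) <= b n) -> norm la <= lb.
Proof.
intros Ha Hb H.
apply (is_lim_seq_le (fun n => norm (sum_n a n)) (sum_n b) (norm la) lb).
- intros n. apply norm_sum_n_le. auto.
- apply (filterlim_comp _ _ _ (sum_n a) norm eventually (locally la)); [exact Ha | apply filterlim_norm].
- exact Hb.
Qed.

Lemma ex_series_nonneg_bounded (a : nat -> R) (M : R) :
  (forall n, 0 <= a n) -> (forall n, sum_n a n <= M) -> ex_series a.
Proof.
intros H HM.
destruct (ex_finite_lim_seq_incr (sum_n a) M) as [l Hl].
- intros n. rewrite sum_Sn. unfold plus; simpl. specialize (H (S n)). lra.
- exact HM.
- exists l. exact Hl.
Qed.

Lemma sum_n_le_series (a : nat -> R) (l : R) :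
  (forall n, 0 <= a n) -> is_series a l -> forall n, sum_n a n <= l.
Proof.
intros H Ha n.
apply (is_lim_seq_incr_compare (sum_n a) l).
- exact Ha.
- intros k. rewrite sum_Sn. unfold plus; simpl. specialize (H (S k)). lra.
Qed.

(** Dominated convergence for series. The cut [n0] depends on [M] alone, so the tails of all [f N]
    and of [g] beyond it are below eps/3 at once, and only finitely many terms are left to converge.
    Truncated double sums are fed into it as series [f N] that vanish beyond some index. *)
Lemma tannery_lim {K : AbsRing} {V : NormedModule K} (f : nat -> nat -> V)
  (g : nat -> V) (M : nat -> R) (s : nat -> V) (l : V) :
  (forall N k, norm (f N k) <= M k) -> ex_series M ->
  (forall k, filterlim (fun N => f N k) eventually (locally (g k))) ->
  (forall N, is_series (f N) (s N)) -> is_series g l -> filterlim s eventually (locally l).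
Proof.
intros HM [lM HlM] Hlim Hs Hl.
assert (HgM : forall k, norm (g k) <= M k) by (intros k; apply (norm_lim_le (fun N => f N k)); auto).
assert (M0 : forall k, 0 <= M k) by (intros k; exact (Rle_trans _ _ _ (norm_ge_0 (V := V) (f 0%nat k)) (HM 0%nat k))).
apply filterlim_norm_iff. intros eps Heps.
assert (Htail : forall (a : nat -> V) la n, (forall k, norm (a k) <= M k) -> is_series a la ->
   norm (minus la (sum_n a n)) <= lM - sum_n M n).
{ intros a la n Ha Hla.
  apply (is_series_norm_le (fun k => a (S n + k)%nat) (fun k => M (S n + k)%nat)).
  - apply is_series_incr_n; [lia|]. simpl.
    eapply eq_ind; [exact Hla|]. symmetry. exact (minus_plus_cancel (G := NormedModule.AbelianGroup K V) _ _).
  - apply is_series_incr_n; [lia|]. simpl. eapply eq_ind; [exact HlM|]. symmetry.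
    exact (minus_plus_cancel (G := R_AbelianGroup) _ _).
  - intros k. apply Ha. }
destruct (proj1 (filterlim_norm_iff (V := R_NormedModule) (sum_n M) lM) HlM (eps/3)) as [n0 Hn0]; [lra|].
specialize (Hn0 n0 (le_n _)).
assert (Hn1 : lM - sum_n M n0 < eps / 3).
{ unfold norm, minus, plus, opp in Hn0; simpl in Hn0. unfold abs in Hn0; simpl in Hn0.
  apply Rabs_def2 in Hn0. lra. }
assert (Hfin : forall n, filterlim (fun N => sum_n (f N) n) eventually (locally (sum_n g n))).
{ induction n as [|n IH].
  - rewrite sum_O. eapply filterlim_ext; [|apply Hlim]. intros N. simpl. now rewrite sum_O.
  - rewrite sum_Sn. eapply filterlim_ext.
    2: eapply filterlim_comp_2; [exact IH | exact (Hlim (S n)) | apply filterlim_plus].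
    intros N. simpl. now rewrite sum_Sn. }
destruct (proj1 (filterlim_norm_iff _ _) (Hfin n0) (eps/3)) as [N HN]; [lra|].
exists N. intros n Hn. specialize (HN n Hn).
replace (minus (s n) l) with
  (plus (minus (s n) (sum_n (f n) n0)) (plus (minus (sum_n (f n) n0) (sum_n g n0)) (minus (sum_n g n0) l))).
2:{ rewrite <- (minus_trans (sum_n g n0) (sum_n (f n) n0) l).
    now rewrite <- (minus_trans (sum_n (f n) n0) (s n) l). }
eapply Rle_lt_trans; [apply norm_triangle|].
assert (H1 := Htail (f n) (s n) n0 (HM n) (Hs n)).
assert (H2 : norm (plus (minus (sum_n (f n) n0) (sum_n g n0)) (minus (sum_n g n0) l)) < eps/3 + eps/3).
{ eapply Rle_lt_trans; [apply norm_triangle|].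
  assert (H3 := Htail g l n0 HgM Hl).
  rewrite <- norm_opp, opp_minus in H3. lra. }
lra.
Qed.

Lemma tannery {K : AbsRing} {V : CompleteNormedModule K} (f : nat -> nat -> V)
  (g : nat -> V) (M : nat -> R) (s : nat -> V) :
  (forall N k, norm (f N k) <= M k) -> ex_series M ->
  (forall k, filterlim (fun N => f N k) eventually (locally (g k))) ->
  (forall N, is_series (f N) (s N)) ->
  exists l, is_series g l /\ filterlim s eventually (locally l).
Proof.
intros HM HexM Hlim Hs.
assert (Hg : ex_series g).
{ apply (ex_series_le g M); [|exact HexM].
  intros k. apply (norm_lim_le (fun N => f N k)); auto. }
destruct Hg as [l Hl]. exists l. split; [exact Hl|].
now apply (tannery_lim f g M).
Qed.

(** * The complex exponential series *)

Lemma Re_plus (a b : C) : Re (a + b) = Re a + Re b. Proof. reflexivity. Qed.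
Lemma Im_plus (a b : C) : Im (a + b) = Im a + Im b. Proof. reflexivity. Qed.
Lemma Re_mult (a b : C) : Re (a * b) = Re a * Re b - Im a * Im b. Proof. reflexivity. Qed.
Lemma Im_mult (a b : C) : Im (a * b) = Re a * Im b + Im a * Re b. Proof. reflexivity. Qed.

Lemma Im_le_Cmod (z : C) : Rabs (Im z) <= Cmod z.
Proof.
eapply Rle_trans; [|apply Rmax_Cmod]. apply Rmax_r.
Qed.

Lemma Cmod_le_Re_Im (z : C) : Cmod z <= Rabs (Re z) + Rabs (Im z).
Proof.
replace z with (RtoC (Re z) + Ci * RtoC (Im z))%C at 1.
2:{ destruct z as [a b]. unfold RtoC, Ci, Cmult, Cplus; simpl. f_equal; ring. }
eapply Rle_trans; [apply Cmod_triangle|].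
rewrite Cmod_mult, Cmod_Ci, !Cmod_R. lra.
Qed.

Lemma Re_sum_n (f : nat -> C) n :
  Re (sum_n (G := C_AbelianMonoid) f n) = sum_n (fun k => Re (f k)) n.
Proof.
induction n as [|n IH]; [now rewrite !sum_O|].
rewrite !sum_Sn. change (Re (sum_n (G := C_AbelianMonoid) f n + f (S n)) = plus (sum_n (fun k => Re (f k)) n) (Re (f (S n)))).
now rewrite Re_plus, IH.
Qed.

Lemma Im_sum_n (f : nat -> C) n :
  Im (sum_n (G := C_AbelianMonoid) f n) = sum_n (fun k => Im (f k)) n.
Proof.
induction n as [|n IH]; [now rewrite !sum_O|].
rewrite !sum_Sn. change (Im (sum_n (G := C_AbelianMonoid) f n + f (S n)) = plus (sum_n (fun k => Im (f k)) n) (Im (f (S n)))).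
now rewrite Im_plus, IH.
Qed.

Lemma filterlim_C_iff (u : nat -> C) (l : C) :
  filterlim u eventually (locally (T := C_NormedModule) l) <->
  (is_lim_seq (fun n => Re (u n)) (Re l) /\ is_lim_seq (fun n => Im (u n)) (Im l)).
Proof.
split.
- intros H. split.
  + apply (proj2 (filterlim_norm_iff (V := R_NormedModule) (fun n => Re (u n)) (Re l))).
    intros eps Heps. destruct (proj1 (filterlim_norm_iff (V := C_NormedModule) u l) H eps Heps) as [N HN].
    exists N. intros n Hn. eapply Rle_lt_trans; [|apply (HN n Hn)].
    apply (re_le_Cmod (u n - l)).
  + apply (proj2 (filterlim_norm_iff (V := R_NormedModule) (fun n => Im (u n)) (Im l))).
    intros eps Heps. destruct (proj1 (filterlim_norm_iff (V := C_NormedModule) u l) H eps Heps) as [N HN].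
    exists N. intros n Hn. eapply Rle_lt_trans; [|apply (HN n Hn)].
    apply (Im_le_Cmod (u n - l)).
- intros [Hr Hi]. apply (proj2 (filterlim_norm_iff (V := C_NormedModule) u l)).
  intros eps Heps.
  destruct (proj1 (filterlim_norm_iff (V := R_NormedModule) (fun n => Re (u n)) (Re l)) Hr (eps/2)) as [N1 H1]; [lra|].
  destruct (proj1 (filterlim_norm_iff (V := R_NormedModule) (fun n => Im (u n)) (Im l)) Hi (eps/2)) as [N2 H2]; [lra|].
  exists (N1 + N2)%nat. intros n Hn.
  specialize (H1 n ltac:(lia)). specialize (H2 n ltac:(lia)).
  eapply Rle_lt_trans; [apply (Cmod_le_Re_Im (u n - l))|].
  change (Rabs (Re (u n - l)) < eps / 2) in H1. change (Rabs (Im (u n - l)) < eps / 2) in H2. lra.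
Qed.

Lemma is_series_C_iff (f : nat -> C) (l : C) :
  is_series (V := C_NormedModule) f l <->
  (is_series (fun k => Re (f k)) (Re l) /\ is_series (fun k => Im (f k)) (Im l)).
Proof.
unfold is_series. rewrite (filterlim_C_iff (sum_n (G := C_AbelianMonoid) f) l).
split; intros [H1 H2]; split.
- eapply filterlim_ext; [|exact H1]. intros n. apply Re_sum_n.
- eapply filterlim_ext; [|exact H2]. intros n. apply Im_sum_n.
- eapply filterlim_ext; [|exact H1]. intros n. symmetry. apply Re_sum_n.
- eapply filterlim_ext; [|exact H2]. intros n. symmetry. apply Im_sum_n.
Qed.

Lemma is_series_RtoC (f : nat -> R) (l : R) :
  is_series f l -> is_series (V := C_NormedModule) (fun k => RtoC (f k)) (RtoC l).
Proof.
intros H. apply is_series_C_iff. simpl. split; [exact H|].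
apply (is_lim_seq_ext (fun _ => 0) (sum_n (fun _ => 0)) 0); [|apply is_lim_seq_const].
intros n. symmetry. induction n as [|n IH]; [now rewrite sum_O|].
rewrite sum_Sn, IH. apply Rplus_0_r.
Qed.

Lemma exp_le_compat (x y : R) : x <= y -> exp x <= exp y.
Proof. intros [H| ->]; [left; now apply exp_increasing|apply Rle_refl]. Qed.

Lemma Cexp_plus (a b : C) : Cexp (a + b) = (Cexp a * Cexp b)%C.
Proof.
unfold Cexp, Cmult. destruct a as [a1 a2], b as [b1 b2]. simpl.
rewrite exp_plus, cos_plus, sin_plus. f_equal; ring.
Qed.

Lemma Cexp_RtoC (x : R) : Cexp (RtoC x) = RtoC (exp x).
Proof. unfold Cexp, RtoC; simpl. rewrite cos_0, sin_0. f_equal; ring. Qed.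

Lemma Cmod_Cexp (z : C) : Cmod (Cexp z) = exp (Re z).
Proof.
unfold Cmod, Cexp; simpl.
replace (_ + _) with (Rsqr (exp (Re z))).
2:{ unfold Rsqr. assert (H := sin2_cos2 (Im z)). unfold Rsqr in H. nra. }
apply sqrt_Rsqr. left. apply exp_pos.
Qed.

Lemma Cpow_polar (r x : R) n :
  ((RtoC r * (cos x, sin x)) ^ n)%C = (r ^ n * cos (INR n * x), r ^ n * sin (INR n * x)).
Proof.
induction n as [|n IH].
- simpl. rewrite Rmult_0_l, cos_0, sin_0. unfold RtoC. f_equal; ring.
- rewrite S_INR, Rmult_plus_distr_r, Rmult_1_l, cos_plus, sin_plus.
  change ((RtoC r * (cos x, sin x)) ^ S n)%C with (RtoC r * (cos x, sin x) * (RtoC r * (cos x, sin x)) ^ n)%C.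
  rewrite IH. unfold Cmult, RtoC; simpl. f_equal; ring.
Qed.

Lemma CV_radius_p_infty (a : nat -> R) :
  (forall r, exists M, forall n, Rabs (a n * r ^ n) <= M) -> CV_radius a = p_infty.
Proof.
intros H. destruct (CV_radius_bounded a) as [Hub _].
destruct (CV_radius a) as [c| |]; [|reflexivity|].
- assert (X := Hub (c + 1) (H _)). simpl in X. lra.
- destruct (Hub 0 (H _)).
Qed.

Lemma ex_series_exp (x : R) : ex_series (fun k => / INR (fact k) * x ^ k).
Proof.
assert (H := proj1 (is_pseries_R _ _ _) (is_exp_Reals x)). eexists. exact H.
Qed.

Lemma pow_div_fact_le_exp (x : R) n : 0 <= x -> / INR (fact n) * x ^ n <= exp x.
Proof.
intros Hx. assert (H := proj1 (is_pseries_R _ _ _) (is_exp_Reals x)).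
assert (H0 : forall k, 0 <= / INR (fact k) * x ^ k).
{ intros k. apply Rmult_le_pos; [left; apply Rinv_0_lt_compat, INR_fact_lt_0 | now apply pow_le]. }
eapply Rle_trans; [|apply (sum_n_le_series _ _ H0 H n)].
destruct n as [|n]; [rewrite sum_O; lra|].
rewrite sum_Sn. unfold plus; cbn [AbelianMonoid.plus]; simpl.
assert (0 <= sum_n (fun k => / INR (fact k) * x ^ k) n).
{ clear -H0. induction n as [|n IH]; [rewrite sum_O; apply H0|].
  rewrite sum_Sn. unfold plus; simpl. specialize (H0 (S n)). simpl in H0. lra. }
lra.
Qed.

(* Along the ray s |-> s z both sides solve the same linear differential equation. *)
Lemma is_series_Cexp (z : C) :
  is_series (V := C_NormedModule) (fun k => RtoC (/ INR (fact k)) * z ^ k)%C (Cexp z).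
Proof.
set (c := fun k => / INR (fact k) * Re (z ^ k)%C).
set (d := fun k => / INR (fact k) * Im (z ^ k)%C).
assert (Hf : forall k, 0 < / INR (fact k)) by (intros k; apply Rinv_0_lt_compat, INR_fact_lt_0).
assert (Hbd : forall (w : R) r n, Rabs w <= Cmod (z ^ n)%C ->
   Rabs (/ INR (fact n) * w * r ^ n) <= exp (Cmod z * Rabs r)).
{ intros w r n Hw. rewrite !Rabs_mult, (Rabs_right (/ INR (fact n))) by (left; apply Hf).
  rewrite <- RPow_abs, Rmult_assoc. eapply Rle_trans; [|apply (pow_div_fact_le_exp _ n)].
  - rewrite Rpow_mult_distr. rewrite Cmod_pow in Hw.
    apply Rmult_le_compat_l; [left; apply Hf|]. apply Rmult_le_compat_r; [apply pow_le, Rabs_pos|exact Hw].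
  - apply Rmult_le_pos; [apply Cmod_ge_0|apply Rabs_pos]. }
assert (Rc : CV_radius c = p_infty).
{ apply CV_radius_p_infty. intros r. exists (exp (Cmod z * Rabs r)). intros n. apply Hbd, re_le_Cmod. }
assert (Rd : CV_radius d = p_infty).
{ apply CV_radius_p_infty. intros r. exists (exp (Cmod z * Rabs r)). intros n. apply Hbd, Im_le_Cmod. }
assert (Pc : forall s, is_pseries c s (PSeries c s)) by (intros s; apply PSeries_correct, CV_radius_inside; now rewrite Rc).
assert (Pd : forall s, is_pseries d s (PSeries d s)) by (intros s; apply PSeries_correct, CV_radius_inside; now rewrite Rd).
assert (Hfact : forall k, INR (S k) * / INR (fact (S k)) = / INR (fact k)).
{ intros k. rewrite fact_simpl, mult_INR. field. split; [apply INR_fact_neq_0 | apply not_0_INR; lia]. }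
set (x := Re z). set (y := Im z).
assert (Dc : forall s, is_derive (PSeries c) s (x * PSeries c s - y * PSeries d s)).
{ intros s. replace (x * PSeries c s - y * PSeries d s) with (PSeries (PS_derive c) s).
  - apply is_derive_PSeries. now rewrite Rc.
  - apply is_pseries_unique. apply is_pseries_R.
    eapply is_series_ext; [|apply (is_series_minus _ _ _ _ (is_series_scal x _ _ (proj1 (is_pseries_R _ _ _) (Pc s)))
       (is_series_scal y _ _ (proj1 (is_pseries_R _ _ _) (Pd s))))].
    intros k. change (x * (c k * s ^ k) + - (y * (d k * s ^ k)) = INR (S k) * c (S k) * s ^ k). unfold c, d.
    rewrite <- (Rmult_assoc (INR (S k))), Hfact. change (z ^ S k)%C with (z * z ^ k)%C. rewrite Re_mult. fold x y. ring. }
assert (Dd : forall s, is_derive (PSeries d) s (y * PSeries c s + x * PSeries d s)).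
{ intros s. replace (y * PSeries c s + x * PSeries d s) with (PSeries (PS_derive d) s).
  - apply is_derive_PSeries. now rewrite Rd.
  - apply is_pseries_unique. apply is_pseries_R.
    eapply is_series_ext; [|apply (is_series_plus _ _ _ _ (is_series_scal y _ _ (proj1 (is_pseries_R _ _ _) (Pc s)))
       (is_series_scal x _ _ (proj1 (is_pseries_R _ _ _) (Pd s))))].
    intros k. change (y * (c k * s ^ k) + x * (d k * s ^ k) = INR (S k) * d (S k) * s ^ k). unfold c, d.
    rewrite <- (Rmult_assoc (INR (S k))), Hfact. change (z ^ S k)%C with (z * z ^ k)%C. rewrite Im_mult. fold x y. ring. }
(* [F] and [G] are the real and imaginary parts of the product of exp(-s z) with the sum of the
   exponential series at s z. Both have derivative zero, so their values at 0 and 1 agree. *)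
set (F := fun s => exp (- (x * s)) * (cos (y * s) * PSeries c s + sin (y * s) * PSeries d s)).
set (G := fun s => exp (- (x * s)) * (cos (y * s) * PSeries d s - sin (y * s) * PSeries c s)).
assert (EF : F 0 = F 1).
{ apply eq_is_derive; [|lra]. intros s _. unfold F. auto_derive.
  - split; [eexists; apply Dc|]. split; [eexists; apply Dd|exact I].
  - rewrite (is_derive_unique (fun u : R => PSeries c u) _ _ (Dc s)), (is_derive_unique (fun u : R => PSeries d u) _ _ (Dd s)). unfold zero; simpl. ring. }
assert (EG : G 0 = G 1).
{ apply eq_is_derive; [|lra]. intros s _. unfold G. auto_derive.
  - split; [eexists; apply Dd|]. split; [eexists; apply Dc|exact I].
  - rewrite (is_derive_unique (fun u : R => PSeries c u) _ _ (Dc s)), (is_derive_unique (fun u : R => PSeries d u) _ _ (Dd s)). unfold zero; simpl. ring. }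
assert (c0 : PSeries c 0 = 1) by (rewrite PSeries_0; unfold c; simpl; field).
assert (d0 : PSeries d 0 = 0) by (rewrite PSeries_0; unfold d; simpl; field).
unfold F in EF. unfold G in EG.
rewrite !Rmult_0_r, cos_0, sin_0, c0, d0, !Rmult_1_r, Ropp_0, exp_0 in EF, EG.
assert (Hexp : exp x * exp (- x) = 1) by (rewrite <- exp_plus, Rplus_opp_r; apply exp_0).
assert (Hcs := sin2_cos2 y). unfold Rsqr in Hcs.
assert (Vc : PSeries c 1 = exp x * cos y).
{ set (u := PSeries c 1) in *. set (v := PSeries d 1) in *.
  assert (E1 : exp x * 1 = cos y * u + sin y * v) by (transitivity ((exp x * exp (-x)) * (cos y * u + sin y * v)); [rewrite Rmult_assoc, <- EF; ring | rewrite Hexp; ring]).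
  assert (E2 : 0 = cos y * v - sin y * u) by (transitivity (exp x * (exp (-x) * (cos y * v - sin y * u))); [rewrite <- EG; ring | rewrite <- Rmult_assoc, Hexp; ring]).
  transitivity ((sin y * sin y + cos y * cos y) * u); [rewrite Hcs; ring|].
  transitivity (cos y * (cos y * u + sin y * v) - sin y * (cos y * v - sin y * u)); [ring|].
  rewrite <- E1, <- E2. ring. }
assert (Vd : PSeries d 1 = exp x * sin y).
{ set (u := PSeries c 1) in *. set (v := PSeries d 1) in *.
  assert (E1 : exp x * 1 = cos y * u + sin y * v) by (transitivity ((exp x * exp (-x)) * (cos y * u + sin y * v)); [rewrite Rmult_assoc, <- EF; ring | rewrite Hexp; ring]).
  assert (E2 : 0 = cos y * v - sin y * u) by (transitivity (exp x * (exp (-x) * (cos y * v - sin y * u))); [rewrite <- EG; ring | rewrite <- Rmult_assoc, Hexp; ring]).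
  transitivity ((sin y * sin y + cos y * cos y) * v); [rewrite Hcs; ring|].
  transitivity (sin y * (cos y * u + sin y * v) + cos y * (cos y * v - sin y * u)); [ring|].
  rewrite <- E1, <- E2. ring. }
apply is_series_C_iff. change (Re (Cexp z)) with (exp x * cos y). change (Im (Cexp z)) with (exp x * sin y).
rewrite <- Vc, <- Vd. split.
- eapply is_series_ext; [|exact (proj1 (is_pseries_R _ _ _) (Pc 1))].
  intros k. unfold c. rewrite pow1, re_scal_l. apply Rmult_1_r.
- eapply is_series_ext; [|exact (proj1 (is_pseries_R _ _ _) (Pd 1))].
  intros k. unfold d. rewrite pow1, im_scal_l. apply Rmult_1_r.
Qed.

(** * The expansion of (1 - w)^(-k-1/2) *)

Local Notation is_Cseries := (is_series (V := C_NormedModule)).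

(* Re-types an equation stated in the carrier of [C_NormedModule], for [ring] and [field]. *)
Ltac as_C := match goal with |- @eq _ ?a ?b => change (@eq C a b) end.
Ltac as_R := match goal with |- @eq _ ?a ?b => change (@eq R a b) end.

(** A total function, built by components, so that [hseries] can be a term; its value is meaningful
    only under convergence. *)
Definition CSeries (f : nat -> C) : C :=
  (Series (fun k => Re (f k)), Series (fun k => Im (f k))).

Lemma is_Cseries_unique (f : nat -> C) (l : C) : is_Cseries f l -> CSeries f = l.
Proof.
intros H. apply is_series_C_iff in H. destruct H as [H1 H2]. unfold CSeries.
rewrite (is_series_unique _ _ H1), (is_series_unique _ _ H2). now destruct l.
Qed.

Lemma CSeries_correct (f : nat -> C) :
  ex_series (V := C_NormedModule) f -> is_Cseries f (CSeries f).
Proof. intros [l H]. now rewrite (is_Cseries_unique _ _ H). Qed.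

Lemma is_Cseries_scal (c : C) (f : nat -> C) (l : C) :
  is_Cseries f l -> is_Cseries (fun k => c * f k)%C (c * l)%C.
Proof. exact (is_series_scal (V := C_NormedModule) c f l). Qed.

Lemma is_Cseries_plus (f g : nat -> C) (l m : C) :
  is_Cseries f l -> is_Cseries g m -> is_Cseries (fun k => f k + g k)%C (l + m)%C.
Proof. exact (is_series_plus (V := C_NormedModule) f g l m). Qed.

Lemma is_Cseries_minus (f g : nat -> C) (l m : C) :
  is_Cseries f l -> is_Cseries g m -> is_Cseries (fun k => f k - g k)%C (l - m)%C.
Proof. exact (is_series_minus (V := C_NormedModule) f g l m). Qed.

Lemma sum_n_first {G : AbelianMonoid} (f : nat -> G) n :
  sum_n f (S n) = plus (f O) (sum_n (fun j => f (S j)) n).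
Proof.
induction n as [|n IH]; [now rewrite sum_Sn, !sum_O|].
now rewrite sum_Sn, IH, sum_Sn, plus_assoc.
Qed.

Lemma sum_n_rev {G : AbelianMonoid} (f : nat -> G) n :
  sum_n (fun j => f (n - j)%nat) n = sum_n f n.
Proof.
induction n as [|n IH]; [now rewrite !sum_O|].
rewrite sum_n_first, sum_Sn, <- IH, Nat.sub_0_r. apply plus_comm.
Qed.

(** Both sides run over the pairs j + k <= n, on the left by antidiagonals and on the right by rows.
    This turns partial sums of a Cauchy product into sums of partial sums, the shape to which
    [tannery_lim] applies. *)
Lemma sum_n_triangle {G : AbelianMonoid} (F : nat -> nat -> G) n :
  sum_n (fun i => sum_n (fun j => F j (i - j)%nat) i) n =
  sum_n (fun j => sum_n (F j) (n - j)%nat) n.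
Proof.
induction n as [|n IH]; [now rewrite !sum_O|].
rewrite sum_Sn, IH, (sum_Sn (fun j => sum_n (F j) (S n - j))).
rewrite sum_Sn, plus_assoc. f_equal.
- rewrite <- sum_n_plus. apply sum_n_ext_loc. intros j Hj.
  replace (S n - j)%nat with (S (n - j)) by lia. now rewrite sum_Sn.
- now rewrite Nat.sub_diag, sum_O.
Qed.

Lemma is_series_finite {K : AbsRing} {V : NormedModule K} (f : nat -> V) N :
  (forall n, (N < n)%nat -> f n = zero) -> is_series f (sum_n f N).
Proof.
intros H. apply (filterlim_ext_loc (fun _ => sum_n f N)); [|apply filterlim_const].
exists N. intros n Hn. induction Hn as [|n Hn IH]; [reflexivity|].
rewrite sum_Sn, <- IH, H by lia. now rewrite plus_zero_r.
Qed.

Lemma sum_n_R_scal (c : R) (f : nat -> R) n : sum_n (fun k => c * f k) n = c * sum_n f n.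
Proof. exact (sum_n_mult_l (K := R_Ring) c f n). Qed.

Lemma sum_n_R_plus (f g : nat -> R) n : sum_n (fun k => f k + g k) n = sum_n f n + sum_n g n.
Proof. exact (sum_n_plus (G := R_AbelianMonoid) f g n). Qed.

Lemma sum_n_R_Sn (f : nat -> R) n : sum_n f (S n) = sum_n f n + f (S n).
Proof. exact (sum_Sn f n). Qed.

Lemma sum_n_R_first (f : nat -> R) n : sum_n f (S n) = f O + sum_n (fun j => f (S j)) n.
Proof. exact (sum_n_first f n). Qed.

Lemma sum_n_C_Sn (f : nat -> C) n :
  sum_n (G := C_AbelianMonoid) f (S n) = (sum_n (G := C_AbelianMonoid) f n + f (S n))%C.
Proof. exact (sum_Sn (G := C_AbelianMonoid) f n). Qed.

Lemma sum_n_R_ext (f g : nat -> R) n :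
  (forall k, (k <= n)%nat -> f k = g k) -> sum_n f n = sum_n g n.
Proof. exact (sum_n_ext_loc f g n). Qed.

(* [hbinom k j] is the binomial coefficient (k + j - 1/2 choose j), the coefficient
   of w^j in (1 - w)^(-k-1/2). *)
Fixpoint hbinom (k j : nat) : R :=
  match j with
  | O => 1
  | S i => hbinom k i * (INR k + INR i + / 2) / (INR i + 1)
  end.

Lemma hbinom_S k j : hbinom k (S j) * (INR j + 1) = hbinom k j * (INR k + INR j + / 2).
Proof. simpl. assert (H := pos_INR j). field. lra. Qed.

Lemma hbinom_pos k j : 0 < hbinom k j.
Proof.
induction j as [|j IH]; [simpl; lra|]. simpl.
assert (H := pos_INR j). assert (H' := pos_INR k).
apply Rdiv_lt_0_compat; [apply Rmult_lt_0_compat|]; lra.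
Qed.

(** Coefficient form of the fact that (1 - w)^(-k-1/2) has derivative (k + 1/2) (1 - w)^(-k-3/2). *)
Lemma hbinom_shift k j : hbinom (S k) j * (INR k + / 2) = hbinom k (S j) * (INR j + 1).
Proof.
rewrite hbinom_S. induction j as [|j IH]; [simpl; ring|].
assert (H := pos_INR j). apply (Rmult_eq_reg_r (INR j + 1)); [|lra].
transitivity (hbinom (S k) (S j) * (INR j + 1) * (INR k + / 2)); [ring|].
rewrite hbinom_S.
transitivity (hbinom k (S j) * (INR j + 1) * (INR k + INR (S j) + / 2)); [|ring].
rewrite hbinom_S, <- IH, !S_INR. ring.
Qed.

(** Coefficient form of (1 - w) (1 - w)^(-k-3/2) = (1 - w)^(-k-1/2). *)
Lemma hbinom_pascal k j : hbinom (S k) (S j) = hbinom (S k) j + hbinom k (S j).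
Proof.
assert (H := pos_INR j). assert (H' := pos_INR k).
apply (Rmult_eq_reg_r (INR j + 1)); [|lra].
rewrite Rmult_plus_distr_r, <- (hbinom_shift k j), hbinom_S, S_INR. ring.
Qed.

Lemma hbinom0_decr j : hbinom 0 (S j) <= hbinom 0 j.
Proof.
assert (H := pos_INR j). apply (Rmult_le_reg_r (INR j + 1)); [lra|].
rewrite hbinom_S. simpl. assert (H1 := hbinom_pos 0 j). nra.
Qed.

Lemma hbinom0_le_1 j : hbinom 0 j <= 1.
Proof.
induction j as [|j IH]; [simpl; lra|]. eapply Rle_trans; [apply hbinom0_decr|exact IH].
Qed.

Lemma hbinom0_fact j :
  hbinom 0 j = INR (fact (2 * j)) / (INR (fact j) * INR (fact j)) / 2 ^ (2 * j).
Proof.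
induction j as [|j IH]; [simpl; field|].
assert (H := pos_INR j). apply (Rmult_eq_reg_r (INR j + 1)); [|lra].
rewrite hbinom_S, IH.
replace (2 * S j)%nat with (S (S (2 * j))) by lia.
rewrite (fact_simpl j), (fact_simpl (S (2 * j))), (fact_simpl (2 * j)), !mult_INR, !S_INR, mult_INR.
rewrite !(pow_add 2 2) || rewrite <- !tech_pow_Rmult. simpl (INR 0). simpl (INR 2).
field. repeat split; try apply INR_fact_neq_0; try lra.
apply pow_nonzero. lra.
Qed.

(** The square of (1 - w)^(-1/2) is the geometric series. For the induction the sum at n + 1 is
    weighted by j: the symmetry j <-> n + 1 - j replaces the weight by its mean (n + 1)/2, the
    recurrence of [hbinom] lowers the index, and the symmetry j <-> n - j turns the weight j + 1/2
    into (n + 1)/2 again. *)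
Lemma hbinom0_convolution n :
  sum_n (fun j => hbinom 0 j * hbinom 0 (n - j)) n = 1.
Proof.
set (b := hbinom 0).
induction n as [|n IH]; [rewrite sum_O; unfold b; simpl; ring|].
assert (Hn := pos_INR n).
apply (Rmult_eq_reg_l (INR n + 1)); [|lra].
assert (E1 : sum_n (fun j => INR j * (b j * b (S n - j)%nat)) (S n) =
   sum_n (fun j => (INR j + /2) * (b j * b (n - j)%nat)) n).
{ rewrite sum_n_R_first. simpl (INR 0). rewrite Rmult_0_l, Rplus_0_l.
  apply sum_n_R_ext. intros j Hj. change (S n - S j)%nat with (n - j)%nat.
  assert (X := hbinom_S 0 j). fold b in X. rewrite S_INR. simpl (INR 0) in X. rewrite <- Rmult_assoc.
  rewrite (Rmult_comm (INR j + 1)), X. ring. }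
assert (E2 : sum_n (fun j => (INR j + /2) * (b j * b (n - j)%nat)) n =
   sum_n (fun j => (INR (n - j) + /2) * (b j * b (n - j)%nat)) n).
{ rewrite <- sum_n_rev. apply sum_n_R_ext. intros j Hj.
  replace (n - (n - j))%nat with j by lia. rewrite (Rmult_comm (b (n - j)%nat)). reflexivity. }
assert (E3 : sum_n (fun j => INR j * (b j * b (S n - j)%nat)) (S n) =
   sum_n (fun j => INR (S n - j) * (b j * b (S n - j)%nat)) (S n)).
{ rewrite <- sum_n_rev. apply sum_n_R_ext. intros j Hj.
  replace (S n - (S n - j))%nat with j by lia. rewrite (Rmult_comm (b (S n - j)%nat)). reflexivity. }
assert (E4 : (INR n + 1) * sum_n (fun j => b j * b (S n - j)%nat) (S n) =
   2 * sum_n (fun j => INR j * (b j * b (S n - j)%nat)) (S n)).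
{ rewrite <- Rplus_diag. rewrite E3 at 2.
  rewrite <- sum_n_R_plus, <- sum_n_R_scal. apply sum_n_R_ext. intros j Hj.
  rewrite minus_INR, S_INR by lia. ring. }
rewrite E4, E1.
rewrite <- Rplus_diag. rewrite E2 at 2.
rewrite <- sum_n_R_plus.
transitivity (sum_n (fun j => (INR n + 1) * (b j * b (n - j)%nat)) n).
- apply sum_n_R_ext. intros j Hj. rewrite minus_INR by lia. field.
- rewrite sum_n_R_scal, IH. reflexivity.
Qed.

(** The exponent is k + 1 and not the sharp k + 1/2, which keeps square roots out. For k = 0 the
    coefficients are at most 1 and the geometric series bounds the sum; multiplication by 1 - r
    lowers k by [hbinom_pascal], up to a last term of favourable sign. *)
Lemma sum_hbinom_le k (r : R) n : 0 <= r < 1 ->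
  sum_n (fun j => hbinom k j * r ^ j) n <= (/ (1 - r)) ^ S k.
Proof.
intros Hr. assert (Hi : 0 < / (1 - r)) by (apply Rinv_0_lt_compat; lra).
revert n. induction k as [|k IH]; intros n.
- rewrite pow_1.
  assert (Hg : is_series (fun j => r ^ j) (/ (1 - r))) by (apply is_series_geom, Rabs_def1; lra).
  apply Rle_trans with (sum_n (fun j => r ^ j) n).
  2: { apply sum_n_le_series; [|exact Hg]. intros j. apply pow_le; lra. }
  clear Hg.
  induction n as [|n IHn]; [rewrite !sum_O; simpl; lra|].
  rewrite !sum_n_R_Sn. apply Rplus_le_compat; [exact IHn|].
  rewrite <- (Rmult_1_l (r ^ S n)) at 2. apply Rmult_le_compat_r; [apply pow_le; lra|apply hbinom0_le_1].
- apply (Rmult_le_reg_l (1 - r)); [lra|].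
  rewrite <- tech_pow_Rmult, <- Rmult_assoc, Rinv_r, Rmult_1_l by lra.
  destruct n as [|n].
  + rewrite sum_O. eapply Rle_trans; [|apply (IH 0%nat)]. rewrite sum_O. simpl. lra.
  + eapply Rle_trans; [|apply (IH (S n))].
    assert (E : sum_n (fun j => hbinom (S k) j * r ^ j) (S n) =
      sum_n (fun j => hbinom k j * r ^ j) (S n) + r * sum_n (fun j => hbinom (S k) j * r ^ j) n).
    { rewrite !(sum_n_R_first _ n), <- sum_n_R_scal, Rplus_assoc, <- sum_n_R_plus.
      f_equal. apply sum_n_R_ext. intros j Hj. rewrite hbinom_pascal, <- tech_pow_Rmult. ring. }
    assert (0 <= hbinom (S k) (S n) * r ^ S n).
    { apply Rmult_le_pos; [left; apply hbinom_pos | apply pow_le; lra]. }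
    rewrite (sum_n_R_Sn (fun j => hbinom (S k) j * r ^ j)) in E |- *. nra.
Qed.

Lemma ex_series_hbinom k (r : R) : 0 <= r < 1 -> ex_series (fun j => hbinom k j * r ^ j).
Proof.
intros Hr. apply (ex_series_nonneg_bounded _ ((/ (1 - r)) ^ S k)).
- intros n. apply Rmult_le_pos; [left; apply hbinom_pos | apply pow_le; lra].
- intros n. now apply sum_hbinom_le.
Qed.

Lemma Cmod_hbinom_term k (w : C) j :
  Cmod (RtoC (hbinom k j) * w ^ j) = hbinom k j * Cmod w ^ j.
Proof.
rewrite Cmod_mult, Cmod_R, Cmod_pow, Rabs_right; [reflexivity|]. left. apply hbinom_pos.
Qed.

Lemma ex_Cseries_hbinom k (w : C) : Cmod w < 1 ->
  ex_series (V := C_NormedModule) (fun j => RtoC (hbinom k j) * w ^ j)%C.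
Proof.
intros Hw. apply (ex_series_le (V := C_CompleteNormedModule) _ (fun j => hbinom k j * Cmod w ^ j)).
- intros j. right. apply Cmod_hbinom_term.
- apply ex_series_hbinom. split; [apply Cmod_ge_0|exact Hw].
Qed.

Lemma Cminus_1_neq_0 (w : C) : Cmod w < 1 -> (1 - w)%C <> 0.
Proof.
intros Hw E. apply Ceq_minus in E. rewrite <- E, Cmod_1 in Hw. lra.
Qed.

Lemma is_Cseries_incr (f : nat -> C) (l : C) :
  is_Cseries f l -> is_Cseries (fun k => f (S k)) (l - f O)%C.
Proof.
intros H. apply is_series_incr_1. eapply eq_ind; [exact H|].
change (l = (l - f O) + f O)%C. ring.
Qed.

Lemma is_Cseries_inj (f : nat -> C) (l m : C) : is_Cseries f l -> is_Cseries f m -> l = m.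
Proof. apply (is_series_inj (V := C_NormedModule)). Qed.

Lemma is_Cseries_hbinom_S k (w L : C) : Cmod w < 1 ->
  is_Cseries (fun j => RtoC (hbinom k j) * w ^ j)%C L ->
  is_Cseries (fun j => RtoC (hbinom (S k) j) * w ^ j)%C (L / (1 - w))%C.
Proof.
intros Hw HL. assert (exists M : C, is_Cseries (fun j => RtoC (hbinom (S k) j) * w ^ j)%C M) as [M HM]
  by exact (ex_Cseries_hbinom (S k) w Hw).
replace (L / (1 - w))%C with M; [exact HM|].
assert (H1 := is_Cseries_incr _ _ HM). assert (H2 := is_Cseries_incr _ _ HL).
assert (H3 := is_Cseries_plus _ _ _ _ H2 (is_Cseries_scal w _ _ HM)).
assert (E : (M - RtoC (hbinom (S k) 0) * w ^ 0 = (L - RtoC (hbinom k 0) * w ^ 0) + w * M)%C).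
{ apply (is_Cseries_inj _ _ _ H1). eapply is_series_ext; [|exact H3].
  intros j. cbv beta. rewrite hbinom_pascal, RtoC_plus. simpl (w ^ S j)%C. as_C; ring. }
simpl in E. assert (Hn := Cminus_1_neq_0 w Hw).
assert (E' : ((1 - w) * M = L)%C).
{ replace L with ((L - 1 * 1 + w * M) + 1 - w * M)%C by ring. rewrite <- E. ring. }
rewrite <- E'. as_C; field. exact Hn.
Qed.

Lemma filterlim_Cscal (c : C) (u : nat -> C) (l : C) :
  filterlim u eventually (locally (T := C_NormedModule) l) ->
  filterlim (fun n => c * u n)%C eventually (locally (T := C_NormedModule) (c * l)%C).
Proof.
intros H. exact (filterlim_comp _ _ _ u (fun x => scal c x) _ _ _ H (filterlim_scal_r (V := C_NormedModule) c l)).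
Qed.

(** The N-th partial sum of the Cauchy product is the sum over j <= N of a_j times the partial sum
    of b up to N - j. These terms are dominated by |a_j| times the total of |b|, and the second
    factor tends to [lb]. *)
Lemma is_Cseries_mult (a b : nat -> C) (la lb : C) :
  is_Cseries a la -> is_Cseries b lb ->
  ex_series (fun n => Cmod (a n)) -> ex_series (fun n => Cmod (b n)) ->
  is_Cseries (fun n => sum_n (G := C_AbelianMonoid) (fun j => a j * b (n - j)%nat)%C n) (la * lb)%C.
Proof.
intros Ha Hb Ea [mb Hmb].
set (T := sum_n (G := C_AbelianMonoid) b).
set (f := fun N j => if (j <=? N)%nat then (a j * T (N - j)%nat)%C else RtoC 0).
set (s := fun N => sum_n (G := C_AbelianMonoid) (f N) N).
assert (HT : forall n, Cmod (T n) <= mb).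
{ intros n. eapply Rle_trans; [apply (norm_sum_n_le (V := C_NormedModule) b (fun n => Cmod (b n)))|].
  - intros k _. apply Rle_refl.
  - apply sum_n_le_series; [intros k; apply Cmod_ge_0|exact Hmb]. }
assert (H0 : 0 <= mb) by (eapply Rle_trans; [apply Cmod_ge_0|apply (HT 0%nat)]).
apply (filterlim_ext s).
- intros N. unfold s. symmetry.
  etransitivity; [exact (sum_n_triangle (G := C_AbelianMonoid) (fun j i => a j * b i)%C N)|].
  apply sum_n_ext_loc. intros j Hj. unfold f. rewrite (proj2 (Nat.leb_le j N) Hj).
  apply (sum_n_mult_l (K := C_Ring)).
- apply (tannery_lim (V := C_NormedModule) f (fun j => a j * lb)%C (fun j => Cmod (a j) * mb) s).
  + intros N j. unfold f. change (norm (V := C_NormedModule)) with Cmod.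
    destruct (j <=? N)%nat.
    * rewrite Cmod_mult. apply Rmult_le_compat_l; [apply Cmod_ge_0|apply HT].
    * rewrite Cmod_0. apply Rmult_le_pos; [apply Cmod_ge_0|exact H0].
  + now apply ex_series_scal_r.
  + intros j. apply (filterlim_ext_loc (fun N => a j * T (N - j)%nat)%C).
    * exists j. intros n Hn. unfold f. now rewrite (proj2 (Nat.leb_le j n) Hn).
    * apply filterlim_Cscal. apply (filterlim_comp _ _ _ (fun N => (N - j)%nat) T _ eventually).
      -- intros P [n0 Hn0]. exists (n0 + j)%nat. intros n Hn. apply Hn0. lia.
      -- exact Hb.
  + intros N. apply (is_series_finite (V := C_NormedModule)). intros n Hn. unfold f.
    now rewrite (proj2 (Nat.leb_gt n N) Hn).
  + rewrite Cmult_comm. eapply is_series_ext; [|exact (is_Cseries_scal lb a la Ha)].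
    intros n. apply Cmult_comm.
Qed.

Lemma is_Cseries_geom (w : C) : Cmod w < 1 -> is_Cseries (fun n => w ^ n)%C (1 / (1 - w))%C.
Proof.
intros Hw.
assert (exists L : C, is_Cseries (fun n => w ^ n)%C L) as [L HL].
{ apply (ex_series_le (V := C_CompleteNormedModule) _ (fun n => Cmod w ^ n)).
  - intros n. change (Cmod (w ^ n) <= Cmod w ^ n). rewrite Cmod_pow. apply Rle_refl.
  - apply ex_series_geom. rewrite Rabs_right; [exact Hw|]. apply Rle_ge, Cmod_ge_0. }
assert (E := is_Cseries_inj _ _ _ (is_Cseries_incr _ _ HL) (is_Cseries_scal w _ _ HL)).
simpl in E. assert (Hn := Cminus_1_neq_0 w Hw).
replace (1 / (1 - w))%C with L; [exact HL|].
assert (E' : ((1 - w) * L = 1)%C).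
{ transitivity (L - w * L)%C; [ring|]. rewrite <- E. ring. }
transitivity ((1 - w) * L / (1 - w))%C; [as_C; field; exact Hn|now rewrite E'].
Qed.

(* The principal branch of (1 - w)^(-1/2). *)
Definition hseries (w : C) : C := CSeries (fun j => RtoC (hbinom 0 j) * w ^ j)%C.

Lemma hseries_correct (w : C) : Cmod w < 1 ->
  is_Cseries (fun j => RtoC (hbinom 0 j) * w ^ j)%C (hseries w).
Proof. intros Hw. apply CSeries_correct, ex_Cseries_hbinom, Hw. Qed.

Lemma is_Cseries_hbinom k (w : C) : Cmod w < 1 ->
  is_Cseries (fun j => RtoC (hbinom k j) * w ^ j)%C (hseries w / (1 - w) ^ k)%C.
Proof.
intros Hw. assert (Hn := Cminus_1_neq_0 w Hw).
induction k as [|k IH].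
- replace (hseries w / (1 - w) ^ 0)%C with (hseries w) by (simpl; field; apply C1_nz).
  now apply hseries_correct.
- replace (hseries w / (1 - w) ^ S k)%C with (hseries w / (1 - w) ^ k / (1 - w))%C.
  + now apply is_Cseries_hbinom_S.
  + simpl. field. split; [now apply Cpow_nz|exact Hn].
Qed.

Lemma hseries_sqr (w : C) : Cmod w < 1 -> (hseries w * hseries w * (1 - w))%C = 1.
Proof.
intros Hw. assert (Hn := Cminus_1_neq_0 w Hw).
assert (Ha : ex_series (fun n => Cmod (RtoC (hbinom 0 n) * w ^ n))).
{ eapply ex_series_ext; [|apply (ex_series_hbinom 0 (Cmod w)); split; [apply Cmod_ge_0|exact Hw]].
  intros n. symmetry. apply Cmod_hbinom_term. }
assert (H := hseries_correct w Hw).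
assert (P := is_Cseries_mult _ _ _ _ H H Ha Ha).
assert (E : (hseries w * hseries w = 1 / (1 - w))%C).
{ apply (is_Cseries_inj _ _ _ P). eapply is_series_ext; [|exact (is_Cseries_geom w Hw)].
  intros n. cbv beta.
  transitivity (RtoC (sum_n (fun j => hbinom 0 j * hbinom 0 (n - j)) n)%R * w ^ n)%C.
  { rewrite hbinom0_convolution. symmetry. apply Cmult_1_l. }
  assert (G : forall m, (m <= n)%nat ->
    (RtoC (sum_n (fun j => hbinom 0 j * hbinom 0 (n - j)) m)%R * w ^ n =
    sum_n (G := C_AbelianMonoid) (fun j => hbinom 0 j * w ^ j * (hbinom 0 (n - j) * w ^ (n - j))) m)%C).
  { assert (Hp : forall j, (j <= n)%nat -> (w ^ n = w ^ j * w ^ (n - j))%C).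
    { intros j Hj. rewrite <- Cpow_add_r. f_equal. lia. }
    induction m as [|m IHm]; intros Hm.
    - rewrite !sum_O. rewrite (Hp 0%nat Hm), RtoC_mult. ring.
    - rewrite sum_n_R_Sn, sum_n_C_Sn, <- IHm by lia.
      rewrite RtoC_plus, Cmult_plus_distr_r. f_equal. rewrite RtoC_mult, (Hp (S m) Hm) at 1. ring. }
  now apply G. }
rewrite E. field. exact Hn.
Qed.

Lemma hseries_Cmod_le (w : C) : Cmod w < 1 -> Cmod (hseries w) <= / (1 - Cmod w).
Proof.
intros Hw. assert (H0 := Cmod_ge_0 w).
apply (norm_lim_le (V := C_NormedModule) _ _ _ (hseries_correct w Hw)).
intros n. eapply Rle_trans; [apply (norm_sum_n_le (V := C_NormedModule) _ (fun j => hbinom 0 j * Cmod w ^ j))|].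
- intros k _. right. apply Cmod_hbinom_term.
- rewrite <- (pow_1 (/ (1 - Cmod w))). now apply sum_hbinom_le.
Qed.

(* The coefficients decrease from 1 to 0, so those of (1 - w) hseries w - 1 have total mass at most 1;
   since (1 - w) hseries w = 1 / hseries w, this selects the branch. *)
Lemma hseries_Re_pos (w : C) : Cmod w < 1 -> 0 < Re (hseries w).
Proof.
intros Hw. assert (H0 := Cmod_ge_0 w). assert (H := hseries_correct w Hw).
set (B := hseries w) in *.
assert (Hb : Cmod ((1 - w) * B - 1) <= Cmod w).
{ set (d := fun j => RtoC (hbinom 0 (S j) - hbinom 0 j)).
  assert (HD : is_Cseries (fun j => d j * w ^ S j)%C ((1 - w) * B - 1)%C).
  { assert (H1 := is_Cseries_minus _ _ _ _ (is_Cseries_incr _ _ H) (is_Cseries_scal w _ _ H)).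
    replace ((1 - w) * B - 1)%C with (B - RtoC (hbinom 0 0) * w ^ 0 - w * B)%C.
    - eapply is_series_ext; [|exact H1]. intros j. cbv beta. unfold d.
      rewrite RtoC_minus. simpl (w ^ S j)%C. as_C; ring.
    - simpl. ring. }
  apply (norm_lim_le (V := C_NormedModule) _ _ _ HD).
  intros n. eapply Rle_trans.
  { apply (norm_sum_n_le (V := C_NormedModule) _ (fun j => Cmod w * (hbinom 0 j - hbinom 0 (S j)))).
    intros k _. change (Cmod (d k * w ^ S k) <= Cmod w * (hbinom 0 k - hbinom 0 (S k))).
    rewrite Cmod_mult, Cmod_pow. unfold d. rewrite Cmod_R, <- tech_pow_Rmult.
    assert (X := hbinom0_decr k). rewrite Rabs_left1 by lra.
    assert (Y : Cmod w ^ k <= 1) by (rewrite <- (pow1 k); apply pow_incr; lra).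
    assert (Y' : 0 <= Cmod w ^ k) by (apply pow_le; lra).
    rewrite Rmult_comm, Rmult_assoc. apply Rmult_le_compat_l; [lra|].
    set (x := hbinom 0 k - hbinom 0 (S k)). replace (- (hbinom 0 (S k) - hbinom 0 k)) with x by (unfold x; ring).
    assert (0 <= x) by (unfold x; lra). nra. }
  rewrite sum_n_R_scal.
  assert (E : sum_n (fun j => hbinom 0 j - hbinom 0 (S j)) n = 1 - hbinom 0 (S n)).
  { clear. induction n as [|n IH]; [rewrite sum_O; reflexivity|].
    rewrite sum_n_R_Sn, IH. change (@eq R (1 - hbinom 0 (S n) + (hbinom 0 (S n) - hbinom 0 (S (S n)))) (1 - hbinom 0 (S (S n)))). ring. }
  rewrite E. assert (X := hbinom_pos 0 (S n)). nra. }
assert (E := hseries_sqr w Hw). fold B in E.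
set (A := ((1 - w) * B)%C) in *.
assert (EA : (B * A = 1)%C) by (rewrite <- E; unfold A; ring).
assert (HA : 0 < Re A).
{ assert (X := re_le_Cmod (A - 1)). replace (Re (A - 1)) with (Re A - 1) in X by reflexivity.
  assert (Y := Rle_abs (- (Re A - 1))). rewrite Rabs_Ropp in Y. lra. }
assert (E1 : Re (B * A) = 1) by now rewrite EA.
assert (E2 : Im (B * A) = 0) by now rewrite EA.
rewrite Re_mult in E1. rewrite Im_mult in E2.
destruct (Rlt_dec 0 (Re B)) as [|Hneg]; [assumption|exfalso].
assert (X : Re A * (Re B * Re A - Im B * Im A) = Re B * (Re A * Re A + Im A * Im A)).
{ transitivity (Re B * (Re A * Re A + Im A * Im A) - Im A * (Re B * Im A + Im B * Re A)); [ring|].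
  rewrite E2. ring. }
rewrite E1 in X. nra.
Qed.

Lemma hseries_neq_0 (w : C) : Cmod w < 1 -> hseries w <> 0.
Proof. intros Hw E. assert (H := hseries_Re_pos w Hw). rewrite E in H. simpl in H. lra. Qed.

(** The square of [hseries w] is the inverse of 1 - w, and 1 - w has positive real part. So the
    square has positive real part too, and together with [hseries_Re_pos] this puts the argument
    strictly between -PI/4 and PI/4. *)
Lemma hseries_Im_lt (w : C) : Cmod w < 1 -> Rabs (Im (hseries w)) < Re (hseries w).
Proof.
intros Hw. assert (HB := hseries_Re_pos w Hw). assert (E := hseries_sqr w Hw).
set (B := hseries w) in *.
set (D := (B * B)%C) in *.
assert (E1 : Re (D * (1 - w)) = 1) by now rewrite E.
assert (E2 : Im (D * (1 - w)) = 0) by now rewrite E.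
rewrite Re_mult in E1. rewrite Im_mult in E2.
assert (Hr : 0 < Re (1 - w)).
{ assert (X := re_le_Cmod w). assert (Y := Rle_abs (Re w)).
  change (Re (1 - w)) with (1 - Re w). lra. }
assert (HD : 0 < Re D).
{ set (p := Re (1 - w)) in *. set (q := Im (1 - w)) in *.
  destruct (Rlt_dec 0 (Re D)) as [|Hneg]; [assumption|exfalso].
  assert (X : p * (Re D * p - Im D * q) = Re D * (p * p + q * q)).
  { transitivity (Re D * (p * p + q * q) - q * (Re D * q + Im D * p)); [ring|]. rewrite E2. ring. }
  rewrite E1 in X. nra. }
unfold D in HD. rewrite Re_mult in HD.
apply Rabs_def1; nra.
Qed.

(** * Laguerre polynomials and Hermite functions *)

(* The generalized Laguerre polynomial L_m^(i - 1/2). *)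
Definition laguerre (i m : nat) (v : R) : R :=
  sum_n (fun k => / INR (fact k) * (- v) ^ k * hbinom (k + i) (m - k)) m.

(** Expand exp(-v w/(1-w)) in powers of w/(1-w). Its k-th term times (1-w)^(-1/2) contains w^k
    (1-w)^(-k-1/2), whose coefficients are [hbinom k]; collecting w^m gives the Laguerre polynomial.
    The partial sums over m are triangular sums in (k, j), to which [tannery_lim] applies. *)
Lemma laguerre_generating (v : R) (w : C) : Cmod w < 1 ->
  is_Cseries (fun m => RtoC (laguerre 0 m v) * w ^ m)%C
    (hseries w * Cexp (- (RtoC v * (w / (1 - w)))))%C.
Proof.
intros Hw. assert (H0 := Cmod_ge_0 w). assert (Hn := Cminus_1_neq_0 w Hw).
set (r := Cmod w) in *.
assert (Hi : 0 < / (1 - r)) by (apply Rinv_0_lt_compat; lra).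
assert (Hf : forall k, 0 < / INR (fact k)) by (intros k; apply Rinv_0_lt_compat, INR_fact_lt_0).
set (T := fun k => sum_n (G := C_AbelianMonoid) (fun j => RtoC (hbinom k j) * w ^ j)%C).
set (c := fun k => (RtoC (/ INR (fact k) * (- v) ^ k)%R * w ^ k)%C).
set (f := fun N k => if (k <=? N)%nat then (c k * T k (N - k)%nat)%C else RtoC 0).
set (s := fun N => sum_n (G := C_AbelianMonoid) (f N) N).
assert (HT : forall k n, Cmod (T k n) <= (/ (1 - r)) ^ S k).
{ intros k n. eapply Rle_trans; [apply (norm_sum_n_le (V := C_NormedModule) _ (fun j => hbinom k j * r ^ j))|].
  - intros j _. right. apply Cmod_hbinom_term.
  - apply sum_hbinom_le. lra. }
(* By [sum_hbinom_le] the k-th row is at most 1/(1-r) times the k-th term of the exponential series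
   at |v| r/(1-r). *)
set (M := fun k => / (1 - r) * (/ INR (fact k) * (Rabs v * r / (1 - r)) ^ k)).
assert (HM : forall k, Cmod (c k) * (/ (1 - r)) ^ S k = M k).
{ intros k. unfold c, M. rewrite Cmod_mult, Cmod_pow, Cmod_R, Rabs_mult, <- RPow_abs, Rabs_Ropp.
  rewrite Rabs_right by (left; apply Hf). fold r. unfold Rdiv. rewrite !Rpow_mult_distr. simpl. ring. }
assert (HS : forall N, s N = sum_n (G := C_AbelianMonoid) (fun m => RtoC (laguerre 0 m v) * w ^ m)%C N).
{ intros N. unfold s.
  transitivity (sum_n (G := C_AbelianMonoid) (fun k => sum_n (G := C_AbelianMonoid)
     (fun j => c k * (RtoC (hbinom k j) * w ^ j))%C (N - k)%nat) N).
  { apply sum_n_ext_loc. intros k Hk. unfold f. rewrite (proj2 (Nat.leb_le k N) Hk).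
    symmetry. apply (sum_n_mult_l (K := C_Ring)). }
  rewrite <- (sum_n_triangle (G := C_AbelianMonoid) (fun k j => c k * (RtoC (hbinom k j) * w ^ j))%C).
  apply sum_n_ext. intros m. unfold laguerre.
  assert (G : forall n, (n <= m)%nat ->
    sum_n (G := C_AbelianMonoid) (fun k => c k * (RtoC (hbinom k (m - k)) * w ^ (m - k)))%C n =
    (RtoC (sum_n (fun k => / INR (fact k) * (- v) ^ k * hbinom (k + 0) (m - k)) n)%R * w ^ m)%C).
  { assert (Hp : forall j, (j <= m)%nat -> (w ^ m = w ^ j * w ^ (m - j))%C).
    { intros j Hj. rewrite <- Cpow_add_r. f_equal. lia. }
    induction n as [|n IH]; intros Hm.
    - rewrite !sum_O. unfold c. rewrite (Hp 0%nat Hm), Nat.add_0_r, (RtoC_mult (_ * _)). as_C; ring.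
    - rewrite sum_n_R_Sn, sum_n_C_Sn, IH by lia.
      rewrite RtoC_plus, Cmult_plus_distr_r. f_equal. unfold c.
      rewrite (Hp (S n) Hm). rewrite Nat.add_0_r, (RtoC_mult (_ * _)). as_C; ring. }
  now apply G. }
apply (filterlim_ext s); [exact HS|].
apply (tannery_lim (V := C_NormedModule) f (fun k => c k * (hseries w / (1 - w) ^ k))%C M s).
- intros N k. change (Cmod (f N k) <= M k). rewrite <- HM. unfold f. destruct (k <=? N)%nat.
  + rewrite Cmod_mult. apply Rmult_le_compat_l; [apply Cmod_ge_0|apply HT].
  + rewrite Cmod_0. apply Rmult_le_pos; [apply Cmod_ge_0|apply pow_le; lra].
- exact (ex_series_scal_l _ _ (ex_series_exp _)).
- intros k. apply (filterlim_ext_loc (fun N => c k * T k (N - k)%nat)%C).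
  + exists k. intros n Hk. unfold f. now rewrite (proj2 (Nat.leb_le k n) Hk).
  + apply filterlim_Cscal. apply (filterlim_comp _ _ _ (fun N => (N - k)%nat) (T k) _ eventually).
    * intros P [n0 Hn0]. exists (n0 + k)%nat. intros n Hk. apply Hn0. lia.
    * exact (is_Cseries_hbinom k w Hw).
- intros N. apply (is_series_finite (V := C_NormedModule)). intros n Hk. unfold f.
  now rewrite (proj2 (Nat.leb_gt n N) Hk).
- eapply is_series_ext; [|exact (is_Cseries_scal (hseries w) _ _ (is_series_Cexp (- (RtoC v * (w / (1 - w))))%C))].
  intros k. cbv beta. unfold c. rewrite RtoC_mult, RtoC_pow, RtoC_opp.
  replace (- (RtoC v * (w / (1 - w))))%C with ((- RtoC v) * w * / (1 - w))%C by (unfold Cdiv; ring).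
  rewrite !Cpow_mult_l, Cpow_inv by exact Hn. unfold Cdiv. as_C; ring.
Qed.

(** On generating functions, differentiation in v multiplies by -w/(1-w) = 1 - 1/(1-w), and the
    factor 1/(1-w) raises i by one. In this form the degree m does not shift, so no index m - 1
    appears. *)
Lemma is_derive_laguerre i m v :
  is_derive (laguerre i m) v (laguerre i m v - laguerre (S i) m v).
Proof.
set (x := fun k => / INR (fact k) * (- v) ^ k).
set (d := fun k => / INR (fact k) * (- INR k * (- v) ^ pred k) * hbinom (k + i) (m - k)).
assert (Hd : is_derive (laguerre i m) v (sum_n d m)).
{ apply (is_derive_sum_n (fun k v => / INR (fact k) * (- v) ^ k * hbinom (k + i) (m - k))).
  intros k _. unfold d. auto_derive; [exact I|]. ring. }
replace (laguerre i m v - laguerre (S i) m v) with (sum_n d m); [exact Hd|].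
assert (Hx : forall k, / INR (fact (S k)) * (- INR (S k) * (- v) ^ pred (S k)) = - x k).
{ intros k. unfold x. rewrite fact_simpl, mult_INR. simpl pred. field.
  split; [apply INR_fact_neq_0|apply not_0_INR; lia]. }
unfold laguerre. fold x. destruct m as [|m].
- rewrite !sum_O. unfold d. simpl. ring.
- rewrite (sum_n_R_first d), !(sum_n_R_Sn _ m).
  replace (d 0%nat) with 0 by (unfold d; simpl (INR 0); ring).
  rewrite Nat.sub_diag. simpl (hbinom _ 0).
  assert (E : sum_n (fun k => x k * hbinom (k + i) (S m - k)) m =
     sum_n (fun k => x k * hbinom (k + S i) (S m - k)) m + sum_n (fun j => d (S j)) m).
  { rewrite <- sum_n_R_plus. apply sum_n_R_ext. intros k Hk. unfold d. rewrite Hx.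
    replace (S m - k)%nat with (S (m - k)) by lia. replace (S m - S k)%nat with (m - k)%nat by lia.
    rewrite Nat.add_succ_r, hbinom_pascal. simpl (S k + i)%nat. ring. }
  change (sum_n (fun k => / INR (fact k) * (- v) ^ k * hbinom (k + i) (S m - k)) m) with
    (sum_n (fun k => x k * hbinom (k + i) (S m - k)) m).
  rewrite E. unfold x. as_R; ring.
Qed.

(** Coefficient of w^m in twice the w-derivative of (1-w)^(-1/2) exp(-v w/(1-w)): the power
    contributes (1-w)^(-3/2), the exponential contributes -2 v (1-w)^(-5/2). *)
Lemma laguerre_contiguous m v :
  laguerre 1 m v - 2 * v * laguerre 2 m v = 2 * (INR m + 1) * laguerre 0 (S m) v.
Proof.
set (x := fun k => / INR (fact k) * (- v) ^ k).
assert (Hx : forall k, v * x k = - (INR (S k) * x (S k))).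
{ intros k. unfold x. rewrite fact_simpl, mult_INR. simpl ((- v) ^ S k). field.
  split; [apply INR_fact_neq_0|apply not_0_INR; lia]. }
set (g := fun k => 2 * (INR k * x k * hbinom (k + 1) (S m - k))).
assert (E1 : - (2 * v * laguerre 2 m v) = sum_n g (S m)).
{ rewrite sum_n_R_first. replace (g 0%nat) with 0 by (unfold g; simpl (INR 0); ring).
  unfold laguerre. rewrite Rplus_0_l, Ropp_mult_distr_l, <- sum_n_R_scal.
  apply sum_n_R_ext. intros k Hk. change (S m - S k)%nat with (m - k)%nat.
  unfold g. replace (S k + 1)%nat with (k + 2)%nat by lia.
  fold (x k). transitivity (- 2 * (v * x k) * hbinom (k + 2) (m - k)); [ring|]. rewrite Hx.
  replace (S m - S k)%nat with (m - k)%nat by lia. ring. }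
unfold Rminus. rewrite E1, sum_n_R_Sn. unfold laguerre. fold x.
rewrite (sum_n_R_Sn _ m), Rmult_plus_distr_l, <- sum_n_R_scal.
rewrite <- Rplus_assoc, <- sum_n_R_plus. f_equal.
- apply sum_n_R_ext. intros k Hk. unfold g. fold (x k).
  rewrite Nat.add_0_r, Nat.add_1_r. replace (S m - k)%nat with (S (m - k)) by lia.
  assert (X := hbinom_shift k (m - k)). assert (Y := hbinom_pascal k (m - k)).
  rewrite Y. rewrite minus_INR in X by lia.
  transitivity (x k * (2 * (hbinom (S k) (m - k) * (INR k + / 2)) + 2 * INR k * hbinom k (S (m - k)))); [field|].
  rewrite X. ring.
- unfold g. rewrite Nat.sub_diag, S_INR. simpl (hbinom _ 0). unfold x. ring.
Qed.

(** Even and odd derivatives alternate. By [is_derive_laguerre] the chain rule yields 2 y (L_i -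
    L_(i+1)), and the part with L_i cancels against the derivative of the Gaussian. From an even
    order only -2 y L_1 survives; from an odd order L_1 - 2 y^2 L_2 survives, and
    [laguerre_contiguous] brings it back to i = 0 with m + 1. *)
Lemma Derive_n_gauss m : forall y,
  Derive_n (fun y => exp (- y ^ 2)) (2 * m) y =
    (-1) ^ m * 4 ^ m * INR (fact m) * laguerre 0 m (y ^ 2) * exp (- y ^ 2) /\
  Derive_n (fun y => exp (- y ^ 2)) (S (2 * m)) y =
    - ((-1) ^ m * 4 ^ m * INR (fact m) * (2 * y) * laguerre 1 m (y ^ 2) * exp (- y ^ 2)).
Proof.
assert (Hodd : forall m, (forall y, Derive_n (fun y => exp (- y ^ 2)) (2 * m) y =
    (-1) ^ m * 4 ^ m * INR (fact m) * laguerre 0 m (y ^ 2) * exp (- y ^ 2)) ->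
  forall y, Derive_n (fun y => exp (- y ^ 2)) (S (2 * m)) y =
    - ((-1) ^ m * 4 ^ m * INR (fact m) * (2 * y) * laguerre 1 m (y ^ 2) * exp (- y ^ 2))).
{ clear m. intros m H y. simpl Derive_n. rewrite (Derive_ext _ _ _ H).
  apply is_derive_unique. set (K := (-1) ^ m * 4 ^ m * INR (fact m)).
  auto_derive; [eexists; apply is_derive_laguerre|].
  rewrite (is_derive_unique (fun u : R => laguerre 0 m u) _ _ (is_derive_laguerre 0 m (y * (y * 1)))).
  simpl. ring. }
induction m as [|m IH].
- assert (H0 : forall y, Derive_n (fun y => exp (- y ^ 2)) (2 * 0) y =
    (-1) ^ 0 * 4 ^ 0 * INR (fact 0) * laguerre 0 0 (y ^ 2) * exp (- y ^ 2)).
  { intros y. unfold laguerre. rewrite sum_O. simpl. field. }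
  intros y. split; [apply H0|]. now apply Hodd.
- assert (H0 : forall y, Derive_n (fun y => exp (- y ^ 2)) (2 * S m) y =
    (-1) ^ S m * 4 ^ S m * INR (fact (S m)) * laguerre 0 (S m) (y ^ 2) * exp (- y ^ 2)).
  { intros y. replace (2 * S m)%nat with (S (S (2 * m))) by lia.
    change (Derive (Derive_n (fun y => exp (- y ^ 2)) (S (2 * m))) y =
      (-1) ^ S m * 4 ^ S m * INR (fact (S m)) * laguerre 0 (S m) (y ^ 2) * exp (- y ^ 2)).
    rewrite (Derive_ext _ _ _ (fun y => proj2 (IH y))).
    apply is_derive_unique. rewrite fact_simpl, mult_INR, S_INR.
    set (K := (-1) ^ m * 4 ^ m * INR (fact m)).
    replace ((-1) ^ S m * 4 ^ S m * ((INR m + 1) * INR (fact m)) * laguerre 0 (S m) (y ^ 2))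
      with (- (2 * K * (2 * (INR m + 1) * laguerre 0 (S m) (y ^ 2)))) by (unfold K; simpl; ring).
    rewrite <- laguerre_contiguous.
    auto_derive; [eexists; apply is_derive_laguerre|].
    rewrite (is_derive_unique (fun u : R => laguerre 1 m u) _ _ (is_derive_laguerre 1 m (y * (y * 1)))).
    simpl. ring. }
  intros y. split; [apply H0|]. now apply Hodd.
Qed.

Lemma Phi_even m x :
  Phi (2 * m) x =
  (-1) ^ m * 4 ^ m * INR (fact m) * laguerre 0 m (2 * (PI * x ^ 2)) * exp (- (PI * x ^ 2)).
Proof.
unfold Phi, hermite. rewrite (proj1 (Derive_n_gauss m _)), pow_1_even.
assert (E : (sqrt (2 * PI) * x) ^ 2 = 2 * (PI * x ^ 2)).
{ rewrite Rpow_mult_distr, pow2_sqrt by (assert (H := PI_RGT_0); lra). ring. }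
rewrite E. set (c := 2 * (PI * x ^ 2)).
assert (X : exp c * exp (- c) = 1) by (rewrite <- exp_plus, Rplus_opp_r; apply exp_0).
transitivity ((exp c * exp (- c)) * ((-1) ^ m * 4 ^ m * INR (fact m) * laguerre 0 m c * exp (- (PI * x ^ 2)))); [ring|].
rewrite X. ring.
Qed.

(** * Cauchy's estimate *)

Lemma is_series_sum_n {K : AbsRing} {V : NormedModule K} (F : nat -> nat -> V) (L : nat -> V) n :
  (forall j, is_series (F j) (L j)) ->
  is_series (fun k => sum_n (fun j => F j k) n) (sum_n L n).
Proof.
intros H. induction n as [|n IH].
- rewrite sum_O. eapply is_series_ext; [|apply (H 0%nat)]. intros k. now rewrite sum_O.
- rewrite sum_Sn. eapply is_series_ext; [|exact (is_series_plus _ _ _ _ IH (H (S n)))].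
  intros k. now rewrite sum_Sn.
Qed.

(* The weights that fold an even sum over [-h..h] to a sum over [0..h]. *)
Definition fold_weight (j : nat) : R := match j with O => 1 | S _ => 2 end.

Lemma fold_weight_pos j : 0 < fold_weight j.
Proof. destruct j; simpl; lra. Qed.

Lemma sum_fold_weight h : sum_n fold_weight h = INR (2 * h + 1).
Proof.
induction h as [|h IH]; [rewrite sum_O; reflexivity|].
rewrite sum_n_R_Sn, IH. replace (2 * S h + 1)%nat with (S (S (2 * h + 1))) by lia.
rewrite !S_INR. simpl fold_weight. as_R; ring.
Qed.

Lemma dirichlet_kernel h x :
  sum_n (fun j => fold_weight j * cos (INR j * x)) h * sin (x / 2) = sin ((INR h + / 2) * x).
Proof.
induction h as [|h IH].
- rewrite sum_O. simpl. rewrite Rmult_0_l, cos_0. replace ((0 + / 2) * x) with (x / 2) by field. ring.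
- rewrite sum_n_R_Sn, Rmult_plus_distr_r, IH. simpl fold_weight.
  rewrite S_INR. replace ((INR h + / 2) * x) with ((INR h + 1) * x - x / 2) by field.
  replace ((INR h + 1 + / 2) * x) with ((INR h + 1) * x + x / 2) by field.
  rewrite sin_minus, sin_plus. ring.
Qed.

Lemma sum_fold_cos_mult h q :
  sum_n (fun j => fold_weight j * cos (INR (q * (2 * h + 1)) * (2 * PI * INR j / INR (2 * h + 1)))) h
  = INR (2 * h + 1).
Proof.
transitivity (sum_n fold_weight h); [|apply sum_fold_weight].
apply sum_n_R_ext. intros j _. rewrite mult_INR.
assert (Hl : INR (2 * h + 1) <> 0) by (apply not_0_INR; lia).
replace (INR q * INR (2 * h + 1) * (2 * PI * INR j / INR (2 * h + 1))) with (0 + 2 * INR (q * j) * PI).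
- rewrite cos_period, cos_0. ring.
- rewrite mult_INR. field. exact Hl.
Qed.

Lemma sin_INR_PI n : sin (INR n * PI) = 0.
Proof. apply sin_eq_0_1. exists (Z.of_nat n). now rewrite <- INR_IZR_INZ. Qed.

(** With the roles of j and k exchanged this is the Dirichlet kernel at x = 2 PI k/(2h+1). The range
    of k puts x/2 strictly between 0 and PI, so sin(x/2) may be divided out, while the numerator is
    sin(k PI) = 0. *)
Lemma sum_fold_cos_0 h k : (0 < k < 2 * h + 1)%nat ->
  sum_n (fun j => fold_weight j * cos (INR k * (2 * PI * INR j / INR (2 * h + 1)))) h = 0.
Proof.
intros Hk.
assert (Hl : 0 < INR (2 * h + 1)) by (apply lt_0_INR; lia).
assert (Hk0 : 0 < INR k) by (apply lt_0_INR; lia).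
assert (Hkl : INR k < INR (2 * h + 1)) by (apply lt_INR; lia).
assert (HP := PI_RGT_0).
set (x := 2 * PI * INR k / INR (2 * h + 1)).
assert (Hs : 0 < sin (x / 2)).
{ replace (x / 2) with (PI * (INR k / INR (2 * h + 1))) by (unfold x; field; lra).
  assert (0 < INR k / INR (2 * h + 1) < 1).
  { split; [now apply Rdiv_lt_0_compat|]. apply (Rmult_lt_reg_r (INR (2 * h + 1))); [exact Hl|].
    unfold Rdiv. rewrite Rmult_assoc, Rinv_l; lra. }
  apply sin_gt_0; nra. }
apply (Rmult_eq_reg_r (sin (x / 2))); [|lra].
rewrite Rmult_0_l.
transitivity (sum_n (fun j => fold_weight j * cos (INR j * x)) h * sin (x / 2)).
- f_equal. apply sum_n_R_ext. intros j _. f_equal. f_equal. unfold x. field. lra.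
- rewrite dirichlet_kernel.
  replace ((INR h + / 2) * x) with (INR k * PI); [apply sin_INR_PI|].
  unfold x. rewrite plus_INR, mult_INR in Hl |- *. simpl (INR 2) in *. simpl (INR 1) in *. field. lra.
Qed.

Lemma sum_fold_abs_le (u : nat -> R) h :
  (forall j, Rabs (u j) <= 1) -> Rabs (sum_n (fun j => fold_weight j * u j) h) <= INR (2 * h + 1).
Proof.
intros H. rewrite <- sum_fold_weight.
apply (norm_sum_n_le (V := R_NormedModule)). intros j _.
change (Rabs (fold_weight j * u j) <= fold_weight j).
rewrite Rabs_mult, Rabs_right by (left; apply fold_weight_pos).
assert (X := fold_weight_pos j). specialize (H j). nra.
Qed.

Lemma Rabs_cos_le_1 x : Rabs (cos x) <= 1.
Proof. assert (H := COS_bound x). apply Rabs_le. lra. Qed.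

(* By averaging over the (2h+1)-st roots of unity, h -> infinity. *)
Lemma cauchy_estimate_cos (a : nat -> R) (F : R -> R) (M : R) :
  ex_series (fun k => Rabs (a k)) ->
  (forall x, is_series (fun k => a k * cos (INR k * x)) (F x)) ->
  (forall x, Rabs (F x) <= M) ->
  forall m, Rabs (a m) <= 2 * M.
Proof.
intros Ha HF HM m.
set (l := fun h => INR (2 * h + 1)).
set (th := fun h j => 2 * PI * INR j / l h).
assert (Hl : forall h, 0 < l h) by (intros h; apply lt_0_INR; lia).
set (f := fun h k => a k * (/ l h * sum_n (fun j => fold_weight j * (cos (INR k * th h j) * cos (INR m * th h j))) h)).
set (s := fun h => / l h * sum_n (fun j => fold_weight j * (F (th h j) * cos (INR m * th h j))) h).
(* The mean of cos(k x) cos(m x) is 1 for k = m = 0, 1/2 for k = m > 0, and 0 otherwise. The 1/2 is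
   the origin of the factor 2 in the conclusion. *)
set (g := fun k => if (k =? m)%nat then (if (m =? 0)%nat then a k else a k / 2) else 0).
assert (Hs : forall h, Rabs (s h) <= M).
{ intros h. unfold s. rewrite Rabs_mult, Rabs_right by (apply Rle_ge; left; apply Rinv_0_lt_compat, Hl).
  apply (Rmult_le_reg_l (l h)); [apply Hl|]. rewrite <- Rmult_assoc, Rinv_r, Rmult_1_l by (apply Rgt_not_eq, Hl).
  assert (M0 : 0 <= M) by (eapply Rle_trans; [apply Rabs_pos|apply (HM 0)]).
  eapply Rle_trans.
  - apply (norm_sum_n_le (V := R_NormedModule) _ (fun j => M * fold_weight j)). intros j _.
    change (Rabs (fold_weight j * (F (th h j) * cos (INR m * th h j))) <= M * fold_weight j).
    rewrite Rabs_mult, Rabs_right by (left; apply fold_weight_pos). rewrite Rmult_comm.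
    apply Rmult_le_compat_r; [left; apply fold_weight_pos|].
    rewrite Rabs_mult. rewrite <- (Rmult_1_r M).
    apply Rmult_le_compat; try apply Rabs_pos; [apply HM|apply Rabs_cos_le_1].
  - rewrite sum_n_R_scal, sum_fold_weight. fold (l h). lra. }
assert (Hlim : filterlim s eventually (locally (T := R_NormedModule) (sum_n g m))).
{ apply (tannery_lim (V := R_NormedModule) f g (fun k => Rabs (a k)) s).
  - intros h k. change (Rabs (f h k) <= Rabs (a k)). unfold f. rewrite !Rabs_mult.
    rewrite <- (Rmult_1_r (Rabs (a k))) at 2. apply Rmult_le_compat_l; [apply Rabs_pos|].
    rewrite Rabs_right by (apply Rle_ge; left; apply Rinv_0_lt_compat, Hl).
    apply (Rmult_le_reg_l (l h)); [apply Hl|]. rewrite <- Rmult_assoc, Rinv_r, Rmult_1_l, Rmult_1_r by (apply Rgt_not_eq, Hl).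
    apply sum_fold_abs_le. intros j. rewrite Rabs_mult, <- (Rmult_1_r 1).
    apply Rmult_le_compat; try apply Rabs_pos; apply Rabs_cos_le_1.
  - exact Ha.
  - intros k. apply (filterlim_ext_loc (fun _ => g k)); [|apply filterlim_const].
    (* For h >= k + m both k + m and |k - m| lie below 2h + 1, so the discrete average already
       equals its limit. With truncated subtraction, |k - m| is written (k - m) + (m - k). *)
    exists (k + m)%nat. intros h Hh. unfold g, f.
    assert (E : sum_n (fun j => fold_weight j * (cos (INR k * th h j) * cos (INR m * th h j))) h =
      / 2 * sum_n (fun j => fold_weight j * cos (INR (k + m) * th h j)) h +
      / 2 * sum_n (fun j => fold_weight j * cos (INR ((k - m) + (m - k)) * th h j)) h).
    { rewrite <- !sum_n_R_scal, <- sum_n_R_plus. apply sum_n_R_ext. intros j _.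
      replace (cos (INR (k - m + (m - k)) * th h j)) with (cos (INR k * th h j - INR m * th h j)).
      - rewrite plus_INR, Rmult_plus_distr_r, cos_minus, cos_plus. field.
      - destruct (Nat.le_gt_cases m k) as [C|C].
        + f_equal. replace (k - m + (m - k))%nat with (k - m)%nat by lia. rewrite minus_INR by lia. ring.
        + rewrite <- cos_neg. f_equal. replace (k - m + (m - k))%nat with (m - k)%nat by lia.
          rewrite minus_INR by lia. ring. }
    rewrite E. unfold th, l.
    assert (L0 : INR (2 * h + 1) <> 0) by (apply not_0_INR; lia).
    destruct (Nat.eqb_spec k m) as [->|Hkm].
    + replace (m - m + (m - m))%nat with (0 * (2 * h + 1))%nat by lia. rewrite sum_fold_cos_mult.
      destruct (Nat.eqb_spec m 0) as [->|Hm].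
      * change (0 + 0)%nat with (0 * (2 * h + 1))%nat. rewrite sum_fold_cos_mult. as_R; field. exact L0.
      * rewrite sum_fold_cos_0 by lia. as_R; field. exact L0.
    + rewrite !sum_fold_cos_0 by lia. as_R; ring.
  - intros h. unfold s, f.
    apply (is_series_ext (fun k => scal (/ l h) (sum_n (fun j => fold_weight j * (a k * cos (INR k * th h j) * cos (INR m * th h j))) h))).
    + intros k. change (/ l h * sum_n (fun j => fold_weight j * (a k * cos (INR k * th h j) * cos (INR m * th h j))) h =
        a k * (/ l h * sum_n (fun j => fold_weight j * (cos (INR k * th h j) * cos (INR m * th h j))) h)).
      rewrite <- Rmult_assoc, (Rmult_comm (a k)), Rmult_assoc, <- (sum_n_R_scal (a k)). f_equal.
      apply sum_n_R_ext. intros j _. ring.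
    + apply (is_series_scal (V := R_NormedModule)).
      apply (is_series_sum_n (V := R_NormedModule)).
      intros j. apply (is_series_scal (V := R_NormedModule)). apply is_series_scal_r. apply HF.
  - apply (is_series_finite (V := R_NormedModule)). intros n Hn. unfold g.
    now rewrite (proj2 (Nat.eqb_neq n m)) by lia. }
assert (X := norm_lim_le (V := R_NormedModule) _ _ _ Hlim Hs).
change (Rabs (sum_n g m) <= M) in X.
assert (Y : sum_n g m = g m).
{ destruct m as [|n]; [now rewrite sum_O|]. rewrite sum_n_R_Sn.
  replace (sum_n g n) with 0; [apply Rplus_0_l|].
  assert (G : forall p, (p <= n)%nat -> sum_n g p = 0).
  { induction p as [|p IHp]; intros Hp.
    - rewrite sum_O. unfold g. now rewrite (proj2 (Nat.eqb_neq 0 (S n))) by lia.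
    - rewrite sum_n_R_Sn, IHp by lia. unfold g. rewrite (proj2 (Nat.eqb_neq (S p) (S n))) by lia. apply Rplus_0_l. }
  symmetry. now apply G. }
rewrite Y in X. unfold g in X. rewrite Nat.eqb_refl in X.
assert (Z := Rabs_pos (a m)).
destruct (m =? 0)%nat; [lra|].
unfold Rdiv in X. rewrite Rabs_mult, (Rabs_right (/ 2)) in X by lra. lra.
Qed.

(** * The coefficients of the Gaussians *)

(* With w = (t^2-1)/(t^2+1), these are the coefficients of (1-w)^(-1/2) exp(-c t^2) in powers of w. *)
Definition tcoef (m : nat) (c : R) : R := laguerre 0 m (2 * c) * exp (- c).

Definition cayley (w : C) : C := ((1 + w) / (1 - w))%C.

(** The identity (1+w)/(1-w) = 1 + 2w/(1-w) splits the exponential; hence the factor exp(-c) and the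
    Laguerre argument 2c. *)
Lemma tcoef_generating (c : R) (w : C) : Cmod w < 1 ->
  is_Cseries (fun m => RtoC (tcoef m c) * w ^ m)%C
    (hseries w * Cexp (- (RtoC c * cayley w)))%C.
Proof.
intros Hw. assert (Hn := Cminus_1_neq_0 w Hw).
replace (- (RtoC c * cayley w))%C with (RtoC (- c) + - (RtoC (2 * c) * (w / (1 - w))))%C.
- rewrite Cexp_plus, Cexp_RtoC.
  replace (hseries w * (RtoC (exp (- c)) * Cexp (- (RtoC (2 * c) * (w / (1 - w))))))%C with
    (RtoC (exp (- c)) * (hseries w * Cexp (- (RtoC (2 * c) * (w / (1 - w))))))%C by ring.
  eapply is_series_ext; [|exact (is_Cseries_scal (RtoC (exp (- c))) _ _ (laguerre_generating (2 * c) w Hw))].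
  intros m. cbv beta. unfold tcoef. rewrite RtoC_mult. as_C; ring.
- unfold cayley. rewrite RtoC_opp, RtoC_mult. field. exact Hn.
Qed.

(** The real part equals (1 - |w|^2)/|1 - w|^2, and |1 - w| <= 1 + |w|. Equality holds at w =
    -|w|. *)
Lemma Re_cayley_ge (w : C) : Cmod w < 1 ->
  (1 - Cmod w) / (1 + Cmod w) <= Re (cayley w).
Proof.
intros Hw. assert (Hn := Cminus_1_neq_0 w Hw). assert (H0 := Cmod_ge_0 w).
assert (E : (cayley w * (1 - w) = 1 + w)%C) by (unfold cayley; field; exact Hn).
assert (E1 : Re (cayley w * (1 - w)) = Re (1 + w)) by now rewrite E.
assert (E2 : Im (cayley w * (1 - w)) = Im (1 + w)) by now rewrite E.
assert (Hr := Cmod2_alt w). assert (Ha := re_le_Cmod w).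
assert (Ha' : - Cmod w <= Re w) by (assert (X := Rle_abs (- Re w)); rewrite Rabs_Ropp in X; lra).
assert (Ha2 : Re w <= Cmod w) by (assert (X := Rle_abs (Re w)); lra).
rewrite Re_mult in E1. rewrite Im_mult in E2.
destruct w as [a b]. destruct (cayley (a, b)) as [x y]. set (r := Cmod (a, b)) in *.
simpl in *.
assert (Hr' : r * r = a * a + b * b) by lra.
assert (EX : x * ((1 - a) ^ 2 + b ^ 2) = (1 - r) * (1 + r)).
{ transitivity (1 - r * r); [rewrite Hr'|ring].
  transitivity ((x * (1 + - a) - y * (0 + - b)) * (1 - a) + (x * (0 + - b) + y * (1 + - a)) * (- b)); [ring|].
  rewrite E1, E2. ring. }
assert (HD : (1 - a) ^ 2 + b ^ 2 <= (1 + r) ^ 2).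
{ replace ((1 - a) ^ 2 + b ^ 2) with (1 - 2 * a + r * r) by (rewrite Hr'; ring). nra. }
assert (HD0 : 0 < (1 - a) ^ 2 + b ^ 2) by (assert (0 < 1 - a) by lra; nra).
set (D := (1 - a) ^ 2 + b ^ 2) in *.
apply (Rmult_le_reg_r D); [exact HD0|]. rewrite EX.
assert (Hq : 0 < (1 - r) / (1 + r)) by (apply Rdiv_lt_0_compat; lra).
eapply Rle_trans; [apply Rmult_le_compat_l; [left; exact Hq|exact HD]|].
right. field. lra.
Qed.

Lemma CV_radius_ge (a : nat -> R) (y : R) :
  0 <= y -> ex_series (fun n => a n * y ^ n) -> Rbar_le y (CV_radius a).
Proof.
intros Hy H. apply Rbar_not_lt_le. intros C. apply (CV_disk_outside a y).
- rewrite Rabs_right by lra. exact C.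
- now apply ex_series_lim_0.
Qed.

Lemma ex_series_Rabs_interior (a : nat -> R) (x y : R) :
  0 <= x < y -> ex_series (fun n => a n * y ^ n) -> ex_series (fun n => Rabs (a n * x ^ n)).
Proof.
intros Hxy Hy. apply CV_disk_inside. rewrite Rabs_right by lra.
apply (Rbar_lt_le_trans _ y); [simpl; lra|]. apply CV_radius_ge; [lra|exact Hy].
Qed.

Lemma is_series_tcoef_real (c x : R) : Rabs x < 1 ->
  is_series (fun m => tcoef m c * x ^ m)
    (Re (hseries (RtoC x) * Cexp (- (RtoC c * cayley (RtoC x))))).
Proof.
intros Hx. assert (Hx' : Cmod (RtoC x) < 1) by now rewrite Cmod_R.
assert (H := proj1 (proj1 (is_series_C_iff _ _) (tcoef_generating c (RtoC x) Hx'))).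
eapply is_series_ext; [|exact H]. intros m. cbv beta.
rewrite re_scal_l, <- RtoC_pow, re_RtoC. reflexivity.
Qed.

Lemma ex_series_tcoef (c r : R) : 0 <= r < 1 -> ex_series (fun m => Rabs (tcoef m c * r ^ m)).
Proof.
intros Hr. apply (ex_series_Rabs_interior _ r ((r + 1) / 2)); [lra|].
eexists. apply is_series_tcoef_real. rewrite Rabs_right; lra.
Qed.

(** The coefficients are real, so the real part of the generating function at w = r e^(ix) is a
    cosine series with coefficients [tcoef m c] r^m, and the right side is twice the maximum modulus
    available on that circle. The decay in c does not depend on m; at c = PI n^2 it becomes the
    Gaussian decay in n that permits the exchange of sums. *)
Lemma tcoef_bound (c r : R) m : 0 <= c -> 0 <= r < 1 ->
  Rabs (tcoef m c) * r ^ m <= 2 * (/ (1 - r) * exp (- (c * ((1 - r) / (1 + r))))).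
Proof.
intros Hc Hr.
set (z := fun x => (RtoC r * (cos x, sin x))%C).
assert (Hz : forall x, Cmod (z x) = r).
{ intros x. unfold z. rewrite Cmod_mult, Cmod_R, Rabs_right by lra.
  unfold Cmod; simpl. replace (_ + _) with 1; [rewrite sqrt_1; ring|].
  assert (H := sin2_cos2 x). unfold Rsqr in H. lra. }
assert (X := cauchy_estimate_cos (fun m => tcoef m c * r ^ m)
  (fun x => Re (hseries (z x) * Cexp (- (RtoC c * cayley (z x)))))
  (/ (1 - r) * exp (- (c * ((1 - r) / (1 + r)))))).
rewrite <- (Rabs_right (r ^ m)) by (apply Rle_ge, pow_le; lra). rewrite <- Rabs_mult.
apply (X (ex_series_tcoef c r Hr)).
- intros x. assert (Hw : Cmod (z x) < 1) by (rewrite Hz; lra).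
  assert (H := proj1 (proj1 (is_series_C_iff _ _) (tcoef_generating c (z x) Hw))).
  eapply is_series_ext; [|exact H]. intros k. cbv beta.
  rewrite re_scal_l. unfold z. rewrite Cpow_polar. simpl Re. as_R; ring.
- intros x. assert (Hw : Cmod (z x) < 1) by (rewrite Hz; lra).
  eapply Rle_trans; [apply re_le_Cmod|]. rewrite Cmod_mult, Cmod_Cexp.
  apply Rmult_le_compat; [apply Cmod_ge_0|left; apply exp_pos| |].
  + rewrite <- (Hz x). now apply hseries_Cmod_le.
  + replace (Re (- (RtoC c * cayley (z x)))) with (- (c * Re (cayley (z x)))) by (simpl; ring).
    apply exp_le_compat. apply Ropp_le_contravar, Rmult_le_compat_l; [exact Hc|].
    rewrite <- (Hz x) at 1 2. now apply Re_cayley_ge.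
Qed.

Lemma ex_series_gauss (d : R) : 0 < d -> ex_series (fun n => exp (- (d * INR n ^ 2))).
Proof.
intros Hd. apply (ex_series_le (V := R_CompleteNormedModule) _ (fun n => exp (- d) ^ n)).
- intros n. change (Rabs (exp (- (d * INR n ^ 2))) <= exp (- d) ^ n).
  rewrite Rabs_right by (left; apply exp_pos).
  rewrite <- (Rpower_pow n (exp (- d))) by apply exp_pos. unfold Rpower. rewrite ln_exp.
  apply exp_le_compat.
  assert (H : INR n <= INR n ^ 2).
  { destruct n as [|n]; [simpl; lra|]. assert (X := pos_INR n). rewrite S_INR. nra. }
  nra.
- apply ex_series_geom. rewrite Rabs_right by (left; apply exp_pos).
  rewrite <- exp_0. apply exp_increasing. lra.
Qed.

(** Sum over n >= 0 only; [thcoef] doubles it and removes the extra copy of n = 0. *)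
Definition gcoef (m : nat) : R := Series (fun n => tcoef m (PI * INR n ^ 2)).

Lemma PI_sq_nonneg n : 0 <= PI * INR n ^ 2.
Proof. assert (H := PI_RGT_0). assert (H' := pow2_ge_0 (INR n)). nra. Qed.

Lemma is_series_gcoef m : is_series (fun n => tcoef m (PI * INR n ^ 2)) (gcoef m).
Proof.
apply Series_correct.
set (d := (1 - / 2) / (1 + / 2)). assert (HP := PI_RGT_0).
assert (Hd : 0 < d) by (unfold d; lra).
apply (ex_series_le (V := R_CompleteNormedModule) _
  (fun n => (2 * / (1 - / 2) * / (/ 2) ^ m) * exp (- (PI * d * INR n ^ 2)))).
- intros n. change (Rabs (tcoef m (PI * INR n ^ 2)) <= 2 * / (1 - / 2) * / (/ 2) ^ m * exp (- (PI * d * INR n ^ 2))).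
  assert (X := tcoef_bound (PI * INR n ^ 2) (/ 2) m (PI_sq_nonneg n) ltac:(lra)). fold d in X.
  assert (Hp : 0 < (/ 2) ^ m) by (apply pow_lt; lra).
  apply (Rmult_le_reg_r ((/ 2) ^ m)); [exact Hp|]. eapply Rle_trans; [exact X|]. right.
  replace (PI * d * INR n ^ 2) with (PI * INR n ^ 2 * d) by ring. field. lra.
- apply (ex_series_scal_l (V := R_NormedModule)). apply ex_series_gauss. nra.
Qed.

Lemma gcoef_generating (w : C) : Cmod w < 1 ->
  exists L : C, is_Cseries (fun n => Cexp (- (RtoC (PI * INR n ^ 2) * cayley w)))%C L /\
    is_Cseries (fun m => RtoC (gcoef m) * w ^ m)%C (hseries w * L)%C.
Proof.
intros Hw. assert (H0 := Cmod_ge_0 w). assert (HP := PI_RGT_0).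
(* The radius r lies strictly between |w| and 1. In [tcoef_bound] this leaves a geometric factor q^m
   with q = |w|/r < 1, so the partial sums over m are bounded uniformly by a summable Gaussian in
   n. *)
set (rho := Cmod w) in *. set (r := (1 + rho) / 2).
assert (Hr : 0 < r < 1) by (unfold r; lra).
set (d := (1 - r) / (1 + r)). assert (Hd : 0 < d) by (apply Rdiv_lt_0_compat; lra).
set (q := rho / r).
assert (Hq : 0 <= q < 1).
{ unfold q, r. split; [apply Rmult_le_pos; [lra|left; apply Rinv_0_lt_compat; lra]|].
  apply (Rmult_lt_reg_r ((1 + rho) / 2)); [lra|]. unfold Rdiv at 1. rewrite Rmult_assoc, Rinv_l; lra. }
set (c := fun n => PI * INR n ^ 2).
set (f := fun N n => sum_n (G := C_AbelianMonoid) (fun m => RtoC (tcoef m (c n)) * w ^ m)%C N).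
set (K := 2 * / (1 - r) * / (1 - q)).
destruct (tannery (V := C_CompleteNormedModule) f
  (fun n => hseries w * Cexp (- (RtoC (c n) * cayley w)))%C
  (fun n => K * exp (- (PI * d * INR n ^ 2)))
  (sum_n (G := C_AbelianMonoid) (fun m => RtoC (gcoef m) * w ^ m)%C)) as [l [Hl1 Hl2]].
- intros N n. unfold f. eapply Rle_trans.
  { apply (norm_sum_n_le (V := C_NormedModule) _ (fun m => (2 * / (1 - r) * exp (- (PI * d * INR n ^ 2))) * q ^ m)).
    intros m _. change (Cmod (RtoC (tcoef m (c n)) * w ^ m) <= 2 * / (1 - r) * exp (- (PI * d * INR n ^ 2)) * q ^ m).
    rewrite Cmod_mult, Cmod_pow, Cmod_R. fold rho.
    assert (X := tcoef_bound (c n) r m (PI_sq_nonneg n) ltac:(lra)). fold d in X.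
    replace rho with (r * q) by (unfold q; field; lra). rewrite Rpow_mult_distr, <- Rmult_assoc.
    apply Rmult_le_compat_r; [apply pow_le; lra|]. eapply Rle_trans; [exact X|]. right.
    unfold c. replace (PI * d * INR n ^ 2) with (PI * INR n ^ 2 * d) by ring. ring. }
  rewrite sum_n_R_scal. unfold K.
  replace (2 * / (1 - r) * / (1 - q) * exp (- (PI * d * INR n ^ 2))) with
    (2 * / (1 - r) * exp (- (PI * d * INR n ^ 2)) * / (1 - q)) by ring.
  apply Rmult_le_compat_l.
  + apply Rmult_le_pos; [|left; apply exp_pos].
    assert (0 < / (1 - r)) by (apply Rinv_0_lt_compat; lra). lra.
  + apply (sum_n_le_series (fun m => q ^ m)); [intros m; apply pow_le; lra|].
    apply is_series_geom. rewrite Rabs_right; lra.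
- apply (ex_series_scal_l (V := R_NormedModule)). apply ex_series_gauss. nra.
- intros n. exact (tcoef_generating (c n) w Hw).
- intros N. apply (is_series_sum_n (V := C_NormedModule) (fun m n => RtoC (tcoef m (c n)) * w ^ m)%C (fun m => RtoC (gcoef m) * w ^ m)%C).
  intros m. rewrite Cmult_comm.
  eapply is_series_ext; [|exact (is_Cseries_scal (w ^ m) _ _ (is_series_RtoC _ _ (is_series_gcoef m)))].
  intros n. apply Cmult_comm.
(* [tannery] has summed the Gaussians multiplied by [hseries w]; dividing by this nonzero constant
   isolates their own sum. *)
- exists (/ hseries w * l)%C. assert (HB := hseries_neq_0 w Hw). split.
  + eapply is_series_ext; [|exact (is_Cseries_scal (/ hseries w) _ _ Hl1)].
    intros n. cbv beta. unfold c. as_C; field. exact HB.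
  + replace (hseries w * (/ hseries w * l))%C with (l : C); [exact Hl2|].
    rewrite Cmult_assoc, Cinv_r by exact HB. now rewrite Cmult_1_l.
Qed.

(** * The functional equation of theta *)

(* [walk m k] is binomial(2m, m + k) / 4^m. *)
Fixpoint walk (m k : nat) : R :=
  match m with
  | O => match k with O => 1 | S _ => 0 end
  | S p => match k with
           | O => (walk p 0 + walk p 1) / 2
           | S j => (walk p j + 2 * walk p (S j) + walk p (S (S j))) / 4
           end
  end.

Lemma walk_nonneg m k : 0 <= walk m k.
Proof.
revert k. induction m as [|m IH]; intros k; destruct k as [|k]; simpl; try lra.
- assert (H := IH 0%nat). assert (H' := IH 1%nat). lra.
- assert (H := IH k). assert (H' := IH (S k)). assert (H'' := IH (S (S k))). lra.
Qed.

Lemma walk_0_pos m : 0 < walk m 0.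
Proof.
induction m as [|m IH]; [simpl; lra|].
change (walk (S m) 0) with ((walk m 0 + walk m 1) / 2). assert (H := walk_nonneg m 1). lra.
Qed.

Lemma walk_out m k : (m < k)%nat -> walk m k = 0.
Proof.
revert k. induction m as [|m IH]; intros k Hk; destruct k as [|k]; try lia; [reflexivity|].
change (walk (S m) (S k)) with ((walk m k + 2 * walk m (S k) + walk m (S (S k))) / 4).
rewrite !IH by lia. field.
Qed.

(** The ratio of neighbouring binomial coefficients, (m - k)/(m + k + 1), derived from the
    recursion. All size estimates for [walk] come from it. *)
Lemma walk_ratio m k : (INR m + INR k + 1) * walk m (S k) = (INR m - INR k) * walk m k.
Proof.
revert k. induction m as [|m IH]; intros k.
- destruct k as [|k]; simpl walk; [simpl; ring|ring].
- destruct k as [|k].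
  + assert (H0 := IH 0%nat). assert (H1 := IH 1%nat).
    change (walk (S m) 1) with ((walk m 0 + 2 * walk m 1 + walk m 2) / 4).
    change (walk (S m) 0) with ((walk m 0 + walk m 1) / 2).
    rewrite S_INR. simpl (INR 0) in *. simpl (INR 1) in *. lra.
  + assert (H0 := IH k). assert (H1 := IH (S k)). assert (H2 := IH (S (S k))).
    change (walk (S m) (S (S k))) with ((walk m (S k) + 2 * walk m (S (S k)) + walk m (S (S (S k)))) / 4).
    change (walk (S m) (S k)) with ((walk m k + 2 * walk m (S k) + walk m (S (S k))) / 4).
    rewrite !S_INR in *. lra.
Qed.

(** Multiplication by 2 + 2 cos x performs one step of the recursion on the Fourier coefficients.
    Cutting the sum at N leaves two boundary terms, which vanish as soon as m < N. *)
Lemma walk_cos_step m N x :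
  (2 + 2 * cos x) * sum_n (fun j => fold_weight j * walk m j * cos (INR j * x)) N =
  4 * sum_n (fun j => fold_weight j * walk (S m) j * cos (INR j * x)) N
  + 2 * walk m N * cos ((INR N + 1) * x) - 2 * walk m (S N) * cos (INR N * x).
Proof.
induction N as [|N IH].
- rewrite !sum_O. simpl (fold_weight 0).
  change (walk (S m) 0) with ((walk m 0 + walk m 1) / 2). simpl (INR 0).
  rewrite Rmult_0_l, cos_0, Rplus_0_l, (Rmult_1_l x). field.
- rewrite !sum_n_R_Sn, !Rmult_plus_distr_l, IH. simpl (fold_weight (S N)).
  change (walk (S m) (S N)) with ((walk m N + 2 * walk m (S N) + walk m (S (S N))) / 4).
  rewrite S_INR.
  assert (E : 2 * (cos x * cos ((INR N + 1) * x)) = cos ((INR N + 1 + 1) * x) + cos (INR N * x)).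
  { replace ((INR N + 1 + 1) * x) with ((INR N + 1) * x + x) by ring.
    replace (INR N * x) with ((INR N + 1) * x - x) by ring.
    rewrite cos_plus, cos_minus. ring. }
  transitivity (4 * sum_n (fun j => fold_weight j * walk (S m) j * cos (INR j * x)) N +
    2 * walk m N * cos ((INR N + 1) * x) - 2 * walk m (S N) * cos (INR N * x) +
    4 * walk m (S N) * cos ((INR N + 1) * x) + 2 * walk m (S N) * (2 * (cos x * cos ((INR N + 1) * x)))); [ring|].
  rewrite E. field.
Qed.

(** Since (1 + cos x)/2 = cos^2(x/2), this is the Fourier expansion of cos^(2m)(x/2), with binomial
    coefficients as Fourier coefficients. *)
Lemma walk_cos m N x : (m <= N)%nat ->
  ((1 + cos x) / 2) ^ m = sum_n (fun j => fold_weight j * walk m j * cos (INR j * x)) N.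
Proof.
intros HN.
assert (G : forall p, (p <= m)%nat ->
  ((1 + cos x) / 2) ^ p = sum_n (fun j => fold_weight j * walk p j * cos (INR j * x)) N).
{ induction p as [|p IH]; intros Hp.
  - clear. induction N as [|N IH].
    + rewrite sum_O. simpl. rewrite Rmult_0_l, cos_0. ring.
    + rewrite sum_n_R_Sn, <- IH. simpl walk. simpl pow. ring.
  - rewrite <- tech_pow_Rmult, IH by lia.
    assert (X := walk_cos_step p N x). rewrite (walk_out p N), (walk_out p (S N)) in X by lia. lra. }
now apply G.
Qed.

Lemma sum_n_R_zero_tail (f : nat -> R) a d :
  (forall k, (a < k <= a + d)%nat -> f k = 0) -> sum_n f (a + d) = sum_n f a.
Proof.
intros H. induction d as [|d IH]; [now rewrite Nat.add_0_r|].
rewrite Nat.add_succ_r, sum_n_R_Sn, IH by (intros; apply H; lia). rewrite H by lia. apply Rplus_0_r.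
Qed.

Lemma sum_n_multiples (f : nat -> R) l Q :
  (forall k, (k mod S l <> 0)%nat -> f k = 0) ->
  sum_n f (Q * S l) = sum_n (fun q => f (q * S l)%nat) Q.
Proof.
intros H. induction Q as [|Q IH]; [now rewrite !sum_O|].
replace (S Q * S l)%nat with (S (Q * S l + l)) by lia.
rewrite sum_n_R_Sn, sum_n_R_zero_tail, IH, sum_n_R_Sn.
- do 2 f_equal. lia.
- intros k Hk. apply H. replace k with ((k - Q * S l) + Q * S l)%nat by lia.
  rewrite Nat.Div0.mod_add, Nat.mod_small; lia.
Qed.

Lemma sum_n_R_switch (F : nat -> nat -> R) m n :
  sum_n (fun i => sum_n (F i) n) m = sum_n (fun j => sum_n (fun i => F i j) m) n.
Proof. exact (sum_n_switch (G := R_AbelianMonoid) F m n). Qed.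

(* Polya: averaging cos^(2m) over the points PI j / (2h+1) keeps the Fourier coefficients with index
   divisible by 2h+1. *)
Lemma polya_identity h m :
  sum_n (fun j => fold_weight j * ((1 + cos (2 * PI * INR j / INR (2 * h + 1))) / 2) ^ m) h =
  INR (2 * h + 1) * sum_n (fun q => fold_weight q * walk m (q * (2 * h + 1))) m.
Proof.
set (th := fun j => 2 * PI * INR j / INR (2 * h + 1)).
(* The cutoff is a multiple of 2h + 1, as [sum_n_multiples] requires, and at least m, as [walk_cos]
   requires. *)
set (N := (m * S (2 * h))%nat).
transitivity (sum_n (fun k => fold_weight k * walk m k *
   sum_n (fun j => fold_weight j * cos (INR k * th j)) h) N).
{ transitivity (sum_n (fun j => sum_n (fun k => fold_weight k * walk m k * (fold_weight j * cos (INR k * th j))) N) h).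
  - apply sum_n_R_ext. intros j _. rewrite (walk_cos m N) by (unfold N; nia).
    rewrite <- sum_n_R_scal. apply sum_n_R_ext. intros k _. fold (th j). ring.
  - rewrite sum_n_R_switch. apply sum_n_R_ext. intros k _. apply sum_n_R_scal. }
unfold N. rewrite sum_n_multiples.
- rewrite <- sum_n_R_scal. apply sum_n_R_ext. intros q _.
  replace (S (2 * h)) with (2 * h + 1)%nat by lia. unfold th. rewrite sum_fold_cos_mult.
  replace (fold_weight (q * (2 * h + 1))) with (fold_weight q).
  + ring.
  + destruct q as [|q]; [reflexivity|]. now replace (S q * (2 * h + 1))%nat with (S (q * (2 * h + 1) + 2 * h))%nat by lia.
- intros k Hk. replace (sum_n (fun j => fold_weight j * cos (INR k * th j)) h) with 0; [ring|]. symmetry.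
  (* At the sample points the cosine depends on k only modulo 2h + 1, and the residue is nonzero
     here. *)
  transitivity (sum_n (fun j => fold_weight j * cos (INR (k mod S (2 * h)) * th j)) h).
  + apply sum_n_R_ext. intros j _. f_equal.
    assert (E := Nat.div_mod_eq k (S (2 * h))).
    set (a := (k / S (2 * h))%nat) in *. set (b := (k mod S (2 * h))%nat) in *.
    rewrite <- (cos_period (INR b * th j) (a * j)). f_equal.
    rewrite E, plus_INR, !mult_INR. unfold th. replace (2 * h + 1)%nat with (S (2 * h)) by lia.
    field. apply not_0_INR. lia.
  + apply sum_fold_cos_0. assert (X := Nat.mod_upper_bound k (S (2 * h))). lia.
Qed.

(** Each ratio is 1 - (2j+1)/(m+j+1) <= exp(-(2j+1)/D), and the odd numbers 2j + 1 for j < k add up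
    to k^2. *)
Lemma walk_le_exp m k D : (k <= m)%nat -> 0 < D -> INR m + INR k <= D ->
  walk m k <= walk m 0 * exp (- (INR k ^ 2 / D)).
Proof.
intros Hk HD. induction k as [|k IH]; intros Hm.
- simpl (INR 0). replace (0 ^ 2 / D) with 0 by (field; lra). rewrite Ropp_0, exp_0. lra.
- rewrite S_INR in *. assert (Hkm : INR k + 1 <= INR m) by (rewrite <- S_INR; now apply le_INR).
  assert (H0 := pos_INR k).
  assert (IH' := IH ltac:(lia) ltac:(lra)). clear IH.
  assert (E := walk_ratio m k).
  set (u := (2 * INR k + 1) / D).
  assert (Hu : INR m - INR k <= (INR m + INR k + 1) * exp (- u)).
  { assert (X := exp_ineq1_le (- u)).
    assert (u <= (2 * INR k + 1) / (INR m + INR k + 1)).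
    { unfold u, Rdiv. apply Rmult_le_compat_l; [lra|]. apply Rinv_le_contravar; lra. }
    assert ((INR m + INR k + 1) * ((2 * INR k + 1) / (INR m + INR k + 1)) = 2 * INR k + 1) by (field; lra).
    nra. }
  assert (S1 : walk m (S k) <= walk m k * exp (- u)).
  { apply (Rmult_le_reg_l (INR m + INR k + 1)); [lra|]. rewrite E.
    assert (W := walk_nonneg m k). nra. }
  eapply Rle_trans; [exact S1|].
  replace (- ((INR k + 1) ^ 2 / D)) with (- (INR k ^ 2 / D) + - u) by (unfold u; field; lra).
  rewrite exp_plus, <- Rmult_assoc. apply Rmult_le_compat_r; [left; apply exp_pos|exact IH'].
Qed.

(** The same product of ratios, bounded below: the inverse ratio is 1 + (2j+1)/(m-j) <=
    exp((2j+1)/D). *)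
Lemma walk_ge_exp m k D : 0 < D -> D <= INR m - INR k ->
  walk m 0 * exp (- (INR k ^ 2 / D)) <= walk m k.
Proof.
intros HD. induction k as [|k IH]; intros Hm.
- simpl (INR 0). replace (0 ^ 2 / D) with 0 by (field; lra). rewrite Ropp_0, exp_0. lra.
- rewrite S_INR in *. assert (H0 := pos_INR k).
  assert (IH' := IH ltac:(lra)). clear IH.
  assert (E := walk_ratio m k).
  set (u := (2 * INR k + 1) / D).
  assert (Hu : INR m + INR k + 1 <= (INR m - INR k) * exp u).
  { assert (X := exp_ineq1_le u).
    assert ((2 * INR k + 1) / (INR m - INR k) <= u).
    { unfold u, Rdiv. apply Rmult_le_compat_l; [lra|]. apply Rinv_le_contravar; lra. }
    assert ((INR m - INR k) * ((2 * INR k + 1) / (INR m - INR k)) = 2 * INR k + 1) by (field; lra).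
    nra. }
  assert (Hee : exp u * exp (- u) = 1) by (rewrite <- exp_plus, Rplus_opp_r; apply exp_0).
  assert (S1 : walk m k * exp (- u) <= walk m (S k)).
  { apply (Rmult_le_reg_l (INR m + INR k + 1)); [lra|]. rewrite E.
    assert (W := walk_nonneg m k). assert (P := exp_pos (- u)).
    apply Rle_trans with ((INR m - INR k) * exp u * (walk m k * exp (- u))).
    - apply Rmult_le_compat_r; [nra|exact Hu].
    - right. transitivity ((INR m - INR k) * walk m k * (exp u * exp (- u))); [ring|]. rewrite Hee. ring. }
  eapply Rle_trans; [|exact S1].
  replace (- ((INR k + 1) ^ 2 / D)) with (- (INR k ^ 2 / D) + - u) by (unfold u; field; lra).
  rewrite exp_plus, <- Rmult_assoc. apply Rmult_le_compat_r; [left; apply exp_pos|exact IH'].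
Qed.

Lemma walk_0_S m : walk (S m) 0 * (2 * INR m + 2) = walk m 0 * (2 * INR m + 1).
Proof.
assert (E := walk_ratio m 0). simpl (INR 0) in E. assert (H := pos_INR m).
change (walk (S m) 0) with ((walk m 0 + walk m 1) / 2).
transitivity ((INR m + 1) * walk m 0 + (INR m + 0 + 1) * walk m 1); [field|]. rewrite E. ring.
Qed.

(** By [walk_0_S] the sequence increases, while (2m+1) [walk m 0]^2 decreases from 1 and bounds it.
    The limit is left unnamed here and is identified as 1/PI only in [theta_functional]. *)
Lemma walk_0_asymptotic : exists kappa : R, is_lim_seq (fun m => INR m * walk m 0 ^ 2) kappa.
Proof.
assert (Hb : forall m, (2 * INR m + 1) * walk m 0 ^ 2 <= 1).
{ induction m as [|m IH]; [simpl; lra|].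
  assert (E := walk_0_S m). assert (H := pos_INR m). rewrite S_INR.
  set (b := walk (S m) 0) in *. set (a := walk m 0) in *.
  apply (Rmult_le_reg_l ((2 * INR m + 2) ^ 2)); [nra|].
  apply Rle_trans with ((2 * INR m + 3) * (2 * INR m + 1) * ((2 * INR m + 1) * a ^ 2)).
  - right. transitivity ((2 * INR m + 3) * (b * (2 * INR m + 2)) ^ 2); [ring|]. rewrite E. ring.
  - assert (0 <= (2 * INR m + 3) * (2 * INR m + 1)) by nra. nra. }
destruct (ex_finite_lim_seq_incr (fun m => INR m * walk m 0 ^ 2) 1) as [k Hk].
- intros m. assert (E := walk_0_S m). assert (H := pos_INR m). rewrite S_INR.
  set (b := walk (S m) 0) in *. set (a := walk m 0) in *.
  apply (Rmult_le_reg_l (4 * (INR m + 1))); [lra|].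
  apply Rle_trans with ((b * (2 * INR m + 2)) ^ 2); [|right; ring]. rewrite E.
  assert (0 <= a ^ 2) by apply pow2_ge_0. nra.
- intros m. specialize (Hb m). assert (H := pos_INR m). assert (0 <= walk m 0 ^ 2) by apply pow2_ge_0. nra.
- now exists k.
Qed.

(** * Jacobi's theta function as the scaling limit of Polya's identity *)

Definition jtheta (x : R) : R := Series (fun n => fold_weight n * exp (- (PI * x * INR n ^ 2))).

Lemma ex_series_theta c : 0 < c -> ex_series (fun n => fold_weight n * exp (- (c * INR n ^ 2))).
Proof.
intros Hc. apply (ex_series_le (V := R_CompleteNormedModule) _ (fun n => 2 * exp (- (c * INR n ^ 2)))).
- intros n. change (Rabs (fold_weight n * exp (- (c * INR n ^ 2))) <= 2 * exp (- (c * INR n ^ 2))).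
  assert (X := exp_pos (- (c * INR n ^ 2))).
  rewrite Rabs_right by (apply Rle_ge, Rmult_le_pos; [left; apply fold_weight_pos|lra]).
  apply Rmult_le_compat_r; [lra|]. destruct n; simpl; lra.
- apply (ex_series_scal_l (V := R_NormedModule)). now apply ex_series_gauss.
Qed.

Lemma is_series_theta x : 0 < x ->
  is_series (fun n => fold_weight n * exp (- (PI * x * INR n ^ 2))) (jtheta x).
Proof.
intros Hx. apply Series_correct, ex_series_theta. assert (H := PI_RGT_0). nra.
Qed.

Lemma theta_pos x : 0 < x -> 0 < jtheta x.
Proof.
intros Hx. eapply Rlt_le_trans; [|apply (sum_n_le_series _ _ (fun n => Rlt_le _ _ (Rmult_lt_0_compat _ _ (fold_weight_pos n) (exp_pos _))) (is_series_theta x Hx) 0%nat)].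
rewrite sum_O. apply Rmult_lt_0_compat; [apply fold_weight_pos|apply exp_pos].
Qed.

Lemma is_lim_seq_exp_opp (u : nat -> R) (l : R) :
  is_lim_seq u l -> is_lim_seq (fun n => exp (- u n)) (exp (- l)).
Proof.
intros H. apply (is_lim_seq_continuous (fun x => exp (- x)) u l); [|exact H].
apply continuity_pt_filterlim. apply (ex_derive_continuous (V := R_NormedModule) (fun x => exp (- x)) l). auto_derive. exact I.
Qed.

Definition npts (h : nat) : R := INR (2 * h + 1).

Lemma npts_pos h : 0 < npts h.
Proof. apply lt_0_INR. lia. Qed.

Lemma is_lim_seq_inv_npts : is_lim_seq (fun h => / npts h) 0.
Proof.
apply (is_lim_seq_le_le (fun _ => 0) _ (fun h => / INR (S h)) 0).
- intros h. split; [left; apply Rinv_0_lt_compat, npts_pos|].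
  apply Rinv_le_contravar; [apply lt_0_INR; lia|]. apply le_INR. lia.
- apply is_lim_seq_const.
- apply is_lim_seq_spec. intros eps.
  destruct (nfloor_ex (/ eps)) as [N HN]; [left; apply Rinv_0_lt_compat, cond_pos|].
  exists N. intros n Hn. rewrite Rminus_0_r, Rabs_right by (left; apply Rinv_0_lt_compat, lt_0_INR; lia).
  rewrite <- (Rinv_inv eps). apply Rinv_lt_contravar.
  + apply Rmult_lt_0_compat; [apply Rinv_0_lt_compat, cond_pos|apply lt_0_INR; lia].
  + rewrite S_INR. apply le_INR in Hn. lra.
Qed.

Lemma sin_bounds u : 0 <= u <= 4 -> u - u ^ 3 / 6 <= sin u <= u.
Proof.
intros Hu. destruct (pre_sin_bound u 0) as [H1 _]; [lra|lra|]. split.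
- eapply Rle_trans; [|exact H1]. right. unfold sin_approx, sin_term. simpl. field.
- destruct (Req_dec u 0) as [->|]; [rewrite sin_0; lra|]. left. apply sin_lt_x. lra.
Qed.

Lemma is_lim_seq_npts_sin (c : R) : 0 <= c ->
  is_lim_seq (fun h => npts h * sin (c / npts h)) c.
Proof.
intros Hc.
assert (L := is_lim_seq_inv_npts).
apply (is_lim_seq_le_le_loc (fun h => c - c ^ 3 / 6 * (/ npts h * / npts h)) _ (fun _ => c)).
- assert (L2 := is_lim_seq_scal_l _ c _ L). simpl in L2.
  apply is_lim_seq_spec in L2. destruct (L2 (mkposreal 4 ltac:(lra))) as [N HN].
  exists N. intros h Hh. specialize (HN h Hh). simpl in HN. rewrite Rmult_0_r, Rminus_0_r in HN.
  assert (P := npts_pos h). assert (P' : 0 < / npts h) by now apply Rinv_0_lt_compat.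
  assert (Q : 0 <= c / npts h <= 4).
  { split; [unfold Rdiv; nra|]. apply Rle_trans with (Rabs (c * / npts h)); [apply Rle_abs|lra]. }
  destruct (sin_bounds _ Q) as [B1 B2]. split.
  + apply Rle_trans with (npts h * (c / npts h - (c / npts h) ^ 3 / 6)).
    * right. field. lra.
    * apply Rmult_le_compat_l; lra.
  + apply Rle_trans with (npts h * (c / npts h)); [apply Rmult_le_compat_l; lra|].
    right. field. lra.
- replace (Finite c) with (Finite (c - c ^ 3 / 6 * (0 * 0))) by (f_equal; ring).
  apply is_lim_seq_minus'; [apply is_lim_seq_const|].
  apply is_lim_seq_mult'; [apply is_lim_seq_const|]. now apply is_lim_seq_mult'.
- apply is_lim_seq_const.
Qed.

Lemma half_one_plus_cos u : (1 + cos (2 * u)) / 2 = 1 - sin u ^ 2.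
Proof. rewrite cos_2a_sin. field. Qed.

Lemma pow_exp (x : R) n : exp x ^ n = exp (INR n * x).
Proof.
induction n as [|n IH]; [simpl; now rewrite Rmult_0_l, exp_0|].
rewrite <- tech_pow_Rmult, IH, <- exp_plus, S_INR. f_equal. ring.
Qed.

Lemma one_minus_pow_le a m : a <= 1 -> (1 - a) ^ m <= exp (- (INR m * a)).
Proof.
intros Ha. replace (- (INR m * a)) with (INR m * - a) by ring. rewrite <- pow_exp. apply pow_incr.
assert (X := exp_ineq1_le (- a)). lra.
Qed.

Lemma one_minus_pow_ge a m : 0 <= a < 1 -> exp (- (INR m * a / (1 - a))) <= (1 - a) ^ m.
Proof.
intros Ha. replace (- (INR m * a / (1 - a))) with (INR m * - (a / (1 - a))) by (field; lra).
rewrite <- pow_exp. apply pow_incr. split; [left; apply exp_pos|].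
assert (X := exp_ineq1_le (a / (1 - a))).
assert (E : exp (a / (1 - a)) * exp (- (a / (1 - a))) = 1) by (rewrite <- exp_plus, Rplus_opp_r; apply exp_0).
replace (1 + a / (1 - a)) with (/ (1 - a)) in X by (field; lra).
assert (P := exp_pos (- (a / (1 - a)))).
apply (Rmult_le_reg_l (/ (1 - a))); [apply Rinv_0_lt_compat; lra|]. rewrite Rinv_l by lra.
eapply Rle_trans; [|right; exact E]. apply Rmult_le_compat_r; lra.
Qed.

(** The scaling in which both sides of [polya_identity] have a limit. With l = 2h + 1 points and m
    close to x l^2/PI, cos^(2m)(PI j/l) tends to exp(-PI x j^2), and the walk at distance q l, of
    relative size about exp(-(q l)^2/m), tends to exp(-PI q^2/x). The slack of 1 allows rounding to
    an integer. *)
Definition diffusive (x : R) (m : nat -> nat) : Prop :=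
  forall h, x / PI * npts h ^ 2 <= INR (m h) <= x / PI * npts h ^ 2 + 1.

Lemma diffusive_exists x : 0 < x -> exists m, diffusive x m.
Proof.
intros Hx. assert (HP := PI_RGT_0).
assert (H0 : forall h, 0 <= x / PI * npts h ^ 2).
{ intros h. apply Rmult_le_pos; [left; now apply Rdiv_lt_0_compat|apply pow2_ge_0]. }
exists (fun h => S (proj1_sig (nfloor_ex _ (H0 h)))). intros h.
destruct (nfloor_ex _ (H0 h)) as [n Hn]. simpl proj1_sig. rewrite S_INR. lra.
Qed.

Lemma npts_ge_1 h : 1 <= npts h.
Proof. unfold npts. rewrite <- INR_1. apply le_INR. lia. Qed.

Lemma is_lim_seq_diffusive x m : diffusive x m ->
  is_lim_seq (fun h => INR (m h) / npts h ^ 2) (x / PI).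
Proof.
intros Hm. assert (L := is_lim_seq_inv_npts).
apply (is_lim_seq_le_le (fun _ => x / PI) _ (fun h => x / PI + / npts h * / npts h)).
- intros h. specialize (Hm h). assert (P := npts_pos h).
  assert (P2 : 0 < / npts h ^ 2) by (apply Rinv_0_lt_compat, pow_lt, P). split.
  + apply Rle_trans with (x / PI * npts h ^ 2 * / npts h ^ 2).
    * right. field. split; [lra|apply PI_neq0].
    * apply Rmult_le_compat_r; lra.
  + apply Rle_trans with ((x / PI * npts h ^ 2 + 1) * / npts h ^ 2).
    * apply Rmult_le_compat_r; lra.
    * right. field. split; [lra|apply PI_neq0].
- apply is_lim_seq_const.
- replace (Finite (x / PI)) with (Finite (x / PI + 0 * 0)) by (f_equal; ring).
  apply is_lim_seq_plus'; [apply is_lim_seq_const|]. now apply is_lim_seq_mult'.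
Qed.

Lemma diffusive_eventually x m : 0 < x -> diffusive x m -> filterlim m eventually eventually.
Proof.
intros Hx Hm P [N HN]. assert (HP := PI_RGT_0).
destruct (nfloor_ex (INR N * (PI / x))) as [K HK].
{ apply Rmult_le_pos; [apply pos_INR|left; now apply Rdiv_lt_0_compat]. }
exists (S K). intros h Hh. apply HN. apply INR_le.
specialize (Hm h). apply le_INR in Hh. rewrite S_INR in Hh.
assert (H1 := npts_ge_1 h).
assert (H2 : INR h <= npts h) by (apply le_INR; lia).
assert (Hxp : 0 < x / PI) by now apply Rdiv_lt_0_compat.
apply Rle_trans with (x / PI * npts h ^ 2); [|lra].
apply Rle_trans with (x / PI * (INR N * (PI / x))); [right; field; lra|].
apply Rmult_le_compat_l; [lra|]. nra.
Qed.

Lemma cos_pow_limit x m j : 0 < x -> diffusive x m ->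
  is_lim_seq (fun h => ((1 + cos (2 * PI * INR j / npts h)) / 2) ^ m h)
    (exp (- (PI * x * INR j ^ 2))).
Proof.
intros Hx Hm. assert (HP := PI_RGT_0). assert (Hj := pos_INR j).
set (s := fun h => npts h * sin (PI * INR j / npts h)).
assert (Ls : is_lim_seq s (PI * INR j)) by (apply is_lim_seq_npts_sin; nra).
set (a := fun h => (s h * / npts h) * (s h * / npts h)).
assert (Lsn : is_lim_seq (fun h => s h * / npts h) 0).
{ replace (Finite 0) with (Finite (PI * INR j * 0)) by (f_equal; ring).
  apply is_lim_seq_mult'; [exact Ls|apply is_lim_seq_inv_npts]. }
assert (La : is_lim_seq a 0).
{ replace (Finite 0) with (Finite (0 * 0)) by (f_equal; ring). now apply is_lim_seq_mult'. }
assert (Lma : is_lim_seq (fun h => INR (m h) * a h) (PI * x * INR j ^ 2)).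
{ replace (Finite (PI * x * INR j ^ 2)) with (Finite (x / PI * (PI * INR j * (PI * INR j)))) by (f_equal; field; lra).
  apply (is_lim_seq_ext (fun h => INR (m h) / npts h ^ 2 * (s h * s h))).
  - intros h. unfold a. field. apply Rgt_not_eq, npts_pos.
  - apply is_lim_seq_mult'; [now apply is_lim_seq_diffusive|]. now apply is_lim_seq_mult'. }
assert (E : forall h, (1 + cos (2 * PI * INR j / npts h)) / 2 = 1 - a h).
{ intros h. replace (2 * PI * INR j / npts h) with (2 * (PI * INR j / npts h)) by (field; apply Rgt_not_eq, npts_pos).
  rewrite half_one_plus_cos. unfold a, s. f_equal. field. apply Rgt_not_eq, npts_pos. }
apply (is_lim_seq_ext (fun h => (1 - a h) ^ m h)); [intros h; now rewrite E|].
apply (is_lim_seq_le_le_loc (fun h => exp (- (INR (m h) * a h / (1 - a h)))) _ (fun h => exp (- (INR (m h) * a h)))).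
- apply is_lim_seq_spec in La. destruct (La (mkposreal 1 Rlt_0_1)) as [N HN]. exists N. intros h Hh.
  specialize (HN h Hh). simpl in HN. rewrite Rminus_0_r in HN. apply Rabs_def2 in HN.
  assert (A0 : 0 <= a h) by (unfold a; nra).
  split; [apply one_minus_pow_ge|apply one_minus_pow_le]; lra.
- apply is_lim_seq_exp_opp. replace (Finite (PI * x * INR j ^ 2)) with (Finite ((PI * x * INR j ^ 2) / (1 - 0))) by (f_equal; field).
  apply is_lim_seq_div'; [exact Lma| |lra]. apply is_lim_seq_minus'; [apply is_lim_seq_const|exact La].
- now apply is_lim_seq_exp_opp.
Qed.

(** Domination for the left side of Polya's identity. The restriction j <= h keeps u = PI j/l at
    most PI/2, where sin u is bounded below by a multiple of u. *)
Lemma cos_pow_bound x m h j : 0 < x -> diffusive x m -> (j <= h)%nat ->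
  0 <= ((1 + cos (2 * PI * INR j / npts h)) / 2) ^ m h <= exp (- (PI * x / 9 * INR j ^ 2)).
Proof.
intros Hx Hm Hjh. assert (HP := PI_RGT_0). assert (HP4 := PI_4). assert (Hj := pos_INR j). assert (P := npts_pos h).
set (u := PI * INR j / npts h).
assert (Hu : 0 <= u <= 2).
{ assert (INR j / npts h <= / 2).
  { apply (Rmult_le_reg_r (2 * npts h)); [lra|]. replace (INR j / npts h * (2 * npts h)) with (2 * INR j) by (field; lra).
    replace (/ 2 * (2 * npts h)) with (npts h) by field. replace 2 with (INR 2) by reflexivity.
    rewrite <- mult_INR. apply le_INR. lia. }
  assert (0 <= INR j / npts h) by (apply Rmult_le_pos; [exact Hj|left; now apply Rinv_0_lt_compat]).
  unfold u. replace (PI * INR j / npts h) with (PI * (INR j / npts h)) by (field; lra). nra. }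
assert (Hs : u / 3 <= sin u).
(* From u <= 2 the factor 1 - u^2/6 is at least 1/3; its square is the 9 in the statement. *)
{ destruct (sin_bounds u) as [B _]; [lra|]. eapply Rle_trans; [|exact B].
  assert (u ^ 2 <= 4) by nra. replace (u - u ^ 3 / 6) with (u * (1 - u ^ 2 / 6)) by field. nra. }
replace (2 * PI * INR j / npts h) with (2 * u) by (unfold u; field; lra).
rewrite half_one_plus_cos.
assert (Hs1 := SIN_bound u).
assert (S2 : sin u ^ 2 <= 1) by nra.
split; [apply pow_le; lra|].
eapply Rle_trans; [now apply one_minus_pow_le|].
apply exp_le_compat, Ropp_le_contravar.
apply Rle_trans with (x / PI * npts h ^ 2 * (u / 3) ^ 2).
- right. unfold u. field. split; lra.
- assert (0 <= x / PI) by (left; now apply Rdiv_lt_0_compat).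
  apply Rmult_le_compat; [apply Rmult_le_pos; [lra|apply pow2_ge_0]|apply pow2_ge_0|apply Hm|apply pow_incr; lra].
Qed.

Lemma walk_ratio_limit x m q : 0 < x -> diffusive x m ->
  is_lim_seq (fun h => walk (m h) (q * (2 * h + 1)) / walk (m h) 0)
    (exp (- (PI * / x * INR q ^ 2))).
Proof.
intros Hx Hm. assert (HP := PI_RGT_0). assert (Hq := pos_INR q).
assert (Hxp : 0 < x / PI) by now apply Rdiv_lt_0_compat.
assert (Lm := is_lim_seq_diffusive x m Hm).
assert (Lq : is_lim_seq (fun h => INR q * / npts h) 0).
{ replace (Finite 0) with (Finite (INR q * 0)) by (f_equal; ring).
  apply is_lim_seq_mult'; [apply is_lim_seq_const|apply is_lim_seq_inv_npts]. }
assert (Lp : is_lim_seq (fun h => INR (m h) / npts h ^ 2 + INR q * / npts h) (x / PI)).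
{ replace (Finite (x / PI)) with (Finite (x / PI + 0)) by (f_equal; ring). now apply is_lim_seq_plus'. }
assert (Ln : is_lim_seq (fun h => INR (m h) / npts h ^ 2 - INR q * / npts h) (x / PI)).
{ replace (Finite (x / PI)) with (Finite (x / PI - 0)) by (f_equal; ring). now apply is_lim_seq_minus'. }
assert (G : forall u, is_lim_seq u (x / PI) -> is_lim_seq (fun h => exp (- (INR q ^ 2 / u h))) (exp (- (PI * / x * INR q ^ 2)))).
{ intros u Hu. apply is_lim_seq_exp_opp.
  replace (Finite (PI * / x * INR q ^ 2)) with (Finite (INR q ^ 2 / (x / PI))) by (f_equal; field; lra).
  apply is_lim_seq_div'; [apply is_lim_seq_const|exact Hu|lra]. }
apply (is_lim_seq_le_le_loc (fun h => exp (- (INR q ^ 2 / (INR (m h) / npts h ^ 2 - INR q * / npts h)))) _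
  (fun h => exp (- (INR q ^ 2 / (INR (m h) / npts h ^ 2 + INR q * / npts h))))).
(* Up to the scale l^2 the two denominators are m - k and m + k for k = q l, the extreme values of D
   in [walk_ge_exp] and [walk_le_exp]. The first one has a positive limit, so k < m for all large
   h. *)
- apply is_lim_seq_spec in Ln. destruct (Ln (mkposreal _ Hxp)) as [N HN]. exists N. intros h Hh.
  specialize (HN h Hh). cbn [pos] in HN. apply Rabs_def2 in HN.
  assert (P := npts_pos h). assert (W := walk_0_pos (m h)).
  set (k := (q * (2 * h + 1))%nat).
  assert (Hk : INR k = INR q * npts h) by (unfold k; rewrite mult_INR; reflexivity).
  assert (Dn : (INR (m h) / npts h ^ 2 - INR q * / npts h) * npts h ^ 2 = INR (m h) - INR k) by (rewrite Hk; field; lra).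
  assert (Dp : (INR (m h) / npts h ^ 2 + INR q * / npts h) * npts h ^ 2 = INR (m h) + INR k) by (rewrite Hk; field; lra).
  assert (P2 : 0 < npts h ^ 2) by now apply pow_lt.
  assert (Q0 : 0 <= INR q * / npts h) by (apply Rmult_le_pos; [exact Hq|left; now apply Rinv_0_lt_compat]).
  set (dn := INR (m h) / npts h ^ 2 - INR q * / npts h) in *.
  set (dp := INR (m h) / npts h ^ 2 + INR q * / npts h) in *.
  assert (Hdn : 0 < dn) by lra. assert (Hdp : 0 < dp) by (unfold dn, dp in *; lra).
  assert (Hmk : INR k < INR (m h)) by (assert (0 < dn * npts h ^ 2) by nra; lra).
  assert (En : INR q ^ 2 / dn = INR k ^ 2 / (INR (m h) - INR k)) by (rewrite <- Dn, Hk; field; lra).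
  assert (Ep : INR q ^ 2 / dp = INR k ^ 2 / (INR (m h) + INR k)) by (rewrite <- Dp, Hk; field; lra).
  rewrite En, Ep. assert (Hk0 := pos_INR k). split.
  + apply (Rmult_le_reg_l (walk (m h) 0)); [exact W|].
    replace (walk (m h) 0 * (walk (m h) k / walk (m h) 0)) with (walk (m h) k) by (field; lra).
    apply walk_ge_exp; lra.
  + apply (Rmult_le_reg_l (walk (m h) 0)); [exact W|].
    replace (walk (m h) 0 * (walk (m h) k / walk (m h) 0)) with (walk (m h) k) by (field; lra).
    apply walk_le_exp; [|lra|lra]. apply Nat.lt_le_incl, INR_lt, Hmk.
- now apply G.
- now apply G.
Qed.

(** Domination for the right side of Polya's identity: for k <= m one may take D = 2m in
    [walk_le_exp], and m <= (x/PI + 1) l^2 because l >= 1. For k > m the walk vanishes. *)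
Lemma walk_ratio_bound x m h q : 0 < x -> diffusive x m ->
  0 <= walk (m h) (q * (2 * h + 1)) / walk (m h) 0 <= exp (- (/ (2 * (x / PI + 1)) * INR q ^ 2)).
Proof.
intros Hx Hm. assert (HP := PI_RGT_0). assert (W := walk_0_pos (m h)). assert (P := npts_ge_1 h).
assert (Hxp : 0 < x / PI) by now apply Rdiv_lt_0_compat.
set (k := (q * (2 * h + 1))%nat).
assert (Hk : INR k = INR q * npts h) by (unfold k; rewrite mult_INR; reflexivity).
split; [apply Rmult_le_pos; [apply walk_nonneg|left; now apply Rinv_0_lt_compat]|].
destruct (Nat.le_gt_cases k (m h)) as [C|C].
2:{ rewrite walk_out by exact C. unfold Rdiv. rewrite Rmult_0_l. left. apply exp_pos. }
destruct (Hm h) as [M1 M2].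
assert (P2 : 1 <= npts h ^ 2) by nra.
assert (Mp : 0 < INR (m h)) by nra.
apply (Rmult_le_reg_l (walk (m h) 0)); [exact W|].
replace (walk (m h) 0 * (walk (m h) k / walk (m h) 0)) with (walk (m h) k) by (field; lra).
eapply Rle_trans; [apply (walk_le_exp _ _ (2 * INR (m h)) C); [lra|apply le_INR in C; lra]|].
apply Rmult_le_compat_l; [lra|]. apply exp_le_compat, Ropp_le_contravar.
rewrite Hk. apply (Rmult_le_reg_r (2 * INR (m h))); [lra|].
replace ((INR q * npts h) ^ 2 / (2 * INR (m h)) * (2 * INR (m h))) with (INR q ^ 2 * npts h ^ 2) by (field; lra).
replace (/ (2 * (x / PI + 1)) * INR q ^ 2 * (2 * INR (m h))) with (INR q ^ 2 * (INR (m h) / (x / PI + 1))).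
2:{ field. split; lra. }
apply Rmult_le_compat_l; [apply pow2_ge_0|].
apply (Rmult_le_reg_r (x / PI + 1)); [lra|].
unfold Rdiv at 1. rewrite Rmult_assoc, Rinv_l by lra. nra.
Qed.

(** Polya's identity reads s1 = l [walk m 0] s2, with s1 tending to [jtheta x] and s2 to
    [jtheta (/ x)]. It is squared and multiplied by m/l^2, so that the prefactor becomes m
    [walk m 0]^2, the quantity whose limit is [kappa]. *)
Lemma theta_square_limit (x kappa : R) : 0 < x ->
  is_lim_seq (fun m => INR m * walk m 0 ^ 2) kappa ->
  jtheta x ^ 2 * x = PI * kappa * jtheta (/ x) ^ 2.
Proof.
intros Hx Hk. destruct (diffusive_exists x Hx) as [m Hm].
assert (HP := PI_RGT_0). assert (Hxp : 0 < x / PI) by now apply Rdiv_lt_0_compat.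
assert (Hix : 0 < / x) by now apply Rinv_0_lt_compat.
set (F := fun h j => fold_weight j * ((1 + cos (2 * PI * INR j / npts h)) / 2) ^ m h).
set (f := fun h j => if (j <=? h)%nat then F h j else 0).
set (s1 := fun h => sum_n (f h) h).
assert (L1 : is_lim_seq s1 (jtheta x)).
{ apply (tannery_lim (V := R_NormedModule) f (fun j => fold_weight j * exp (- (PI * x * INR j ^ 2)))
    (fun j => fold_weight j * exp (- (PI * x / 9 * INR j ^ 2)))).
  - intros h j. change (Rabs (f h j) <= fold_weight j * exp (- (PI * x / 9 * INR j ^ 2))).
    assert (W := fold_weight_pos j). unfold f. destruct (Nat.leb_spec j h) as [C|C].
    + assert (B := cos_pow_bound x m h j Hx Hm C). unfold F.
      rewrite Rabs_right by (apply Rle_ge, Rmult_le_pos; lra). apply Rmult_le_compat_l; lra.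
    + rewrite Rabs_R0. apply Rmult_le_pos; [lra|left; apply exp_pos].
  - apply ex_series_theta. nra.
  - intros j. apply (filterlim_ext_loc (fun h => F h j)).
    + exists j. intros h Hh. unfold f. now rewrite (proj2 (Nat.leb_le j h) Hh).
    + exact (is_lim_seq_scal_l _ (fold_weight j) _ (cos_pow_limit x m j Hx Hm)).
  - intros h. apply (is_series_finite (V := R_NormedModule)). intros j Hj. unfold f.
    now rewrite (proj2 (Nat.leb_gt j h) Hj).
  - now apply is_series_theta. }
set (g := fun h q => fold_weight q * (walk (m h) (q * (2 * h + 1)) / walk (m h) 0)).
set (s2 := fun h => sum_n (g h) (m h)).
assert (L2 : is_lim_seq s2 (jtheta (/ x))).
{ apply (tannery_lim (V := R_NormedModule) g (fun j => fold_weight j * exp (- (PI * / x * INR j ^ 2)))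
    (fun j => fold_weight j * exp (- (/ (2 * (x / PI + 1)) * INR j ^ 2)))).
  - intros h j. change (Rabs (g h j) <= fold_weight j * exp (- (/ (2 * (x / PI + 1)) * INR j ^ 2))).
    assert (W := fold_weight_pos j). assert (B := walk_ratio_bound x m h j Hx Hm). unfold g.
    rewrite Rabs_right by (apply Rle_ge, Rmult_le_pos; lra). apply Rmult_le_compat_l; lra.
  - apply ex_series_theta. apply Rinv_0_lt_compat. lra.
  - intros j. exact (is_lim_seq_scal_l _ (fold_weight j) _ (walk_ratio_limit x m j Hx Hm)).
  - intros h. apply (is_series_finite (V := R_NormedModule)). intros j Hj. unfold g.
    rewrite walk_out by nia. unfold Rdiv. rewrite Rmult_0_l. apply Rmult_0_r.
  - now apply is_series_theta. }
assert (E : forall h, s1 h = npts h * walk (m h) 0 * s2 h).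
{ intros h. transitivity (sum_n (F h) h).
  { apply sum_n_R_ext. intros j Hj. unfold f. now rewrite (proj2 (Nat.leb_le j h) Hj). }
  unfold F. etransitivity; [exact (polya_identity h (m h))|]. fold (npts h).
  rewrite Rmult_assoc. f_equal. unfold s2. rewrite <- sum_n_R_scal. apply sum_n_R_ext. intros q _.
  unfold g. field. apply Rgt_not_eq, walk_0_pos. }
assert (Lk : is_lim_seq (fun h => INR (m h) * walk (m h) 0 ^ 2) kappa).
{ exact (filterlim_comp _ _ _ m (fun m => INR m * walk m 0 ^ 2) _ _ _ (diffusive_eventually x m Hx Hm) Hk). }
assert (La : is_lim_seq (fun h => INR (m h) / npts h ^ 2 * (s1 h * s1 h)) (x / PI * (jtheta x * jtheta x))).
{ apply is_lim_seq_mult'; [now apply is_lim_seq_diffusive|]. now apply is_lim_seq_mult'. }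
assert (Lb : is_lim_seq (fun h => INR (m h) / npts h ^ 2 * (s1 h * s1 h)) (kappa * (jtheta (/ x) * jtheta (/ x)))).
{ apply (is_lim_seq_ext (fun h => INR (m h) * walk (m h) 0 ^ 2 * (s2 h * s2 h))).
  - intros h. rewrite E. field. apply Rgt_not_eq, npts_pos.
  - apply is_lim_seq_mult'; [exact Lk|]. now apply is_lim_seq_mult'. }
assert (Q := is_lim_seq_unique _ _ La). rewrite (is_lim_seq_unique _ _ Lb) in Q.
injection Q as Q.
transitivity (PI * (x / PI * (jtheta x * jtheta x))); [field; lra|]. rewrite <- Q. ring.
Qed.

(** At x = 1 the same positive number [jtheta 1]^2 stands on both sides of [theta_square_limit],
    hence PI kappa = 1. *)
Lemma theta_functional x : 0 < x -> jtheta x ^ 2 * x = jtheta (/ x) ^ 2.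
Proof.
intros Hx. destruct walk_0_asymptotic as [kappa Hk].
assert (H1 := theta_square_limit 1 kappa Rlt_0_1 Hk). rewrite Rinv_1, Rmult_1_r in H1.
assert (P := theta_pos 1 Rlt_0_1).
assert (Ek : PI * kappa = 1).
{ apply (Rmult_eq_reg_r (jtheta 1 ^ 2)); [lra|]. apply Rgt_not_eq, pow_lt, P. }
rewrite (theta_square_limit x kappa Hx Hk), Ek. ring.
Qed.

(** * The expansion of the theta series *)

(* These are the numbers (-1)^m S_{2m}; see [ZSeries_Phi]. *)
Definition thcoef (m : nat) : R := 2 * gcoef m - tcoef m 0.

Lemma thcoef_generating (w : C) : Cmod w < 1 ->
  exists L : C, is_Cseries (fun n => Cexp (- (RtoC (PI * INR n ^ 2) * cayley w)))%C L /\
    is_Cseries (fun m => RtoC (thcoef m) * w ^ m)%C (hseries w * (2 * L - 1))%C.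
Proof.
intros Hw. destruct (gcoef_generating w Hw) as [L [H1 H2]]. exists L. split; [exact H1|].
assert (H3 := tcoef_generating 0 w Hw).
replace (hseries w * (2 * L - 1))%C with
  (2 * (hseries w * L) - hseries w * Cexp (- (RtoC 0 * cayley w)))%C.
- eapply is_series_ext; [|exact (is_Cseries_minus _ _ _ _ (is_Cseries_scal 2 _ _ H2) H3)].
  intros m. cbv beta. unfold thcoef. rewrite RtoC_minus, RtoC_mult. as_C; ring.
- replace (- (RtoC 0 * cayley w))%C with (RtoC 0) by ring. rewrite Cexp_RtoC, exp_0. ring.
Qed.

Lemma theta_half_series (x L : R) : 0 < x ->
  is_series (fun n => exp (- (PI * x * INR n ^ 2))) L -> jtheta x = 2 * L - 1.
Proof.
intros Hx HL. set (e := fun n => exp (- (PI * x * INR n ^ 2))) in *.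
assert (H0 : e 0%nat = 1).
{ unfold e. simpl (INR 0). replace (- (PI * x * 0 ^ 2)) with 0 by ring. apply exp_0. }
set (d := fun n => match n with O => 1 | S _ => 0 end).
assert (Hd : is_series d (sum_n d 0)).
{ apply (is_series_finite (V := R_NormedModule)). intros n Hn. destruct n; [lia|reflexivity]. }
rewrite sum_O in Hd.
apply is_series_unique.
eapply is_series_ext; [|exact (is_series_minus (V := R_NormedModule) _ _ _ _ (is_series_scal (V := R_NormedModule) 2 _ _ HL) Hd)].
intros n. change (2 * e n + - d n = fold_weight n * e n).
destruct n as [|n]; [rewrite H0|]; simpl; ring.
Qed.

Lemma hseries_real (x : R) : Rabs x < 1 ->
  exists b : R, hseries (RtoC x) = RtoC b /\ 0 < b /\ b * b * (1 - x) = 1.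
Proof.
intros Hx. assert (Hx' : Cmod (RtoC x) < 1) by now rewrite Cmod_R.
assert (H := hseries_correct _ Hx').
assert (Hs : ex_series (fun j => hbinom 0 j * x ^ j)).
{ apply ex_series_Rabs. eapply ex_series_ext; [|apply (ex_series_hbinom 0 (Rabs x)); split; [apply Rabs_pos|exact Hx]].
  intros j. cbv beta. rewrite Rabs_mult, RPow_abs, (Rabs_right (hbinom 0 j)); [reflexivity|]. left. apply hbinom_pos. }
set (b := Series (fun j => hbinom 0 j * x ^ j)).
assert (E : hseries (RtoC x) = RtoC b).
{ apply (is_Cseries_inj _ _ _ H). eapply is_series_ext; [|apply (is_series_RtoC _ _ (Series_correct _ Hs))].
  intros j. cbv beta. now rewrite RtoC_mult, RtoC_pow. }
exists b. split; [exact E|].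
assert (HR := hseries_Re_pos _ Hx'). assert (HS := hseries_sqr _ Hx').
rewrite E in HR, HS. split; [exact HR|].
apply RtoC_inj. rewrite !RtoC_mult, RtoC_minus. exact HS.
Qed.

(** For real w = x the generating function is [jtheta] divided by the square root of 1 - x. The
    relation is squared to match [theta_functional]; positivity of v keeps the information about the
    sign. *)
Lemma thcoef_real (x : R) : Rabs x < 1 ->
  exists v, 0 < v /\ is_series (fun m => thcoef m * x ^ m) v /\
    v ^ 2 * (1 - x) = jtheta ((1 + x) / (1 - x)) ^ 2.
Proof.
intros Hx. assert (Hx' : Cmod (RtoC x) < 1) by now rewrite Cmod_R.
assert (Hx2 := Rabs_def2 _ _ Hx).
destruct (hseries_real x Hx) as [b [Eb [Hb Hbb]]].
destruct (thcoef_generating _ Hx') as [L [H1 H2]].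
set (X := (1 + x) / (1 - x)).
assert (HX : 0 < X) by (apply Rdiv_lt_0_compat; lra).
assert (Hc : cayley (RtoC x) = RtoC X).
{ unfold cayley, X. rewrite RtoC_div by lra. now rewrite RtoC_plus, RtoC_minus. }
assert (Hg : is_series (fun n => exp (- (PI * X * INR n ^ 2))) (Re L)).
{ apply is_series_C_iff in H1. destruct H1 as [H1 _].
  eapply is_series_ext; [|exact H1]. intros n. cbv beta.
  rewrite Hc, <- RtoC_mult, <- RtoC_opp, Cexp_RtoC, re_RtoC. f_equal. ring. }
assert (HL : L = RtoC (Re L)).
{ apply (is_Cseries_inj _ _ _ H1). eapply is_series_ext; [|apply (is_series_RtoC _ _ Hg)].
  intros n. cbv beta. rewrite Hc, <- RtoC_mult, <- RtoC_opp, Cexp_RtoC. do 2 f_equal. ring. }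
assert (Ht := theta_half_series X (Re L) HX Hg).
exists (b * jtheta X). split; [apply Rmult_lt_0_compat; [exact Hb|now apply theta_pos]|]. split.
- apply is_series_C_iff in H2. destruct H2 as [H2 _].
  replace (b * jtheta X) with (Re (hseries (RtoC x) * (2 * L - 1))%C).
  + eapply is_series_ext; [|exact H2]. intros m. cbv beta.
    now rewrite re_scal_l, <- RtoC_pow, re_RtoC.
  + rewrite Eb, re_scal_l, HL, Ht, <- RtoC_mult, <- RtoC_minus. reflexivity.
- transitivity ((b * b * (1 - x)) * jtheta X ^ 2); [ring|]. rewrite Hbb. ring.
Qed.

(* The functional equation of theta says that the generating function of [thcoef] is even. *)
Lemma thcoef_odd m : thcoef (S (2 * m)) = 0.
Proof.
assert (Hex : forall x, Rabs x < 1 -> ex_series (fun n => thcoef n * x ^ n)).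
{ intros x Hx. destruct (thcoef_real x Hx) as [v [_ [H _]]]. now exists v. }
assert (Hsgn : forall x n, (-1) ^ n * thcoef n * x ^ n = thcoef n * (- x) ^ n).
{ intros x n. replace (- x) with (-1 * x) by ring. rewrite Rpow_mult_distr. ring. }
assert (E : thcoef (S (2 * m)) = (-1) ^ S (2 * m) * thcoef (S (2 * m))).
{ apply (PSeries_ext_recip thcoef (fun n => (-1) ^ n * thcoef n)).
  - apply (Rbar_lt_le_trans _ (/ 2)); [simpl; lra|]. apply CV_radius_ge; [lra|]. apply Hex. rewrite Rabs_right; lra.
  - apply (Rbar_lt_le_trans _ (/ 2)); [simpl; lra|]. apply CV_radius_ge; [lra|].
    apply (ex_series_ext (fun n => thcoef n * (- / 2) ^ n)); [intros n; symmetry; apply Hsgn|].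
    apply Hex. rewrite Rabs_left; lra.
  - exists (mkposreal 1 Rlt_0_1). intros x Hx.
    assert (Hx1 : Rabs x < 1).
    { change (Rabs (x - 0) < 1) in Hx. now rewrite Rminus_0_r in Hx. }
    assert (Hx2 : Rabs (- x) < 1) by now rewrite Rabs_Ropp.
    assert (Hx3 := Rabs_def2 _ _ Hx1).
    destruct (thcoef_real x Hx1) as [u [Hu [Su Eu]]].
    destruct (thcoef_real (- x) Hx2) as [v [Hv [Sv Ev]]].
    assert (P1 : PSeries thcoef x = u) by (apply is_pseries_unique, is_pseries_R; exact Su).
    assert (P2 : PSeries (fun n => (-1) ^ n * thcoef n) x = v).
    { apply is_pseries_unique, is_pseries_R. eapply is_series_ext; [|exact Sv]. intros n. symmetry. apply Hsgn. }
    rewrite P1, P2.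
    set (X := (1 + x) / (1 - x)) in *.
    assert (HX : 0 < X) by (apply Rdiv_lt_0_compat; lra).
    replace ((1 + - x) / (1 - - x)) with (/ X) in Ev by (unfold X; field; lra).
    (* The change x -> -x inverts X, so (1+x) v^2 = X [jtheta X]^2 = X (1-x) u^2 = (1+x) u^2. As u
       and v are positive, they coincide. *)
    rewrite <- (theta_functional X HX), <- Eu in Ev.
    assert (Euv : u ^ 2 = v ^ 2).
    { apply (Rmult_eq_reg_r (1 - - x)); [|lra]. rewrite Ev. unfold X. field. lra. }
    assert ((u - v) * (u + v) = 0) by (transitivity (u ^ 2 - v ^ 2); [ring|lra]).
    apply Rmult_integral in H. lra. }
rewrite pow_1_odd in E. lra.
Qed.

(** The partial sums of the thinned series form the subsequence of even-indexed partial sums of the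
    original one. *)
Lemma is_Cseries_even (f : nat -> C) (l : C) :
  (forall m, f (S (2 * m)) = RtoC 0) -> is_Cseries f l -> is_Cseries (fun m => f (2 * m)%nat) l.
Proof.
intros H0 H.
assert (E : forall n, sum_n (G := C_AbelianMonoid) f (2 * n) = sum_n (G := C_AbelianMonoid) (fun m => f (2 * m)%nat) n).
{ induction n as [|n IH]; [now rewrite !sum_O|].
  replace (2 * S n)%nat with (S (S (2 * n))) by lia.
  rewrite !sum_n_C_Sn, H0, IH. replace (2 * S n)%nat with (S (S (2 * n))) by lia. as_C; ring. }
apply (filterlim_ext (fun n => sum_n (G := C_AbelianMonoid) f (2 * n)) _ E).
apply (filterlim_comp _ _ _ (fun n => (2 * n)%nat) (sum_n (G := C_AbelianMonoid) f) _ eventually).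
- intros P [N HN]. exists N. intros n Hn. apply HN. lia.
- exact H.
Qed.

(** * From Gaussian coefficients to the constants [alpha_even] *)

Lemma tcoef_Phi m x :
  Phi (2 * m) x = (-1) ^ m * 4 ^ m * INR (fact m) * tcoef m (PI * x ^ 2).
Proof. rewrite Phi_even. unfold tcoef. ring. Qed.

Lemma ZSeries_Phi m :
  ZSeries (fun n => Phi (2 * m) (IZR n)) = (-1) ^ m * 4 ^ m * INR (fact m) * thcoef m.
Proof.
set (K := (-1) ^ m * 4 ^ m * INR (fact m)).
set (g := fun n => tcoef m (PI * INR n ^ 2)).
assert (H := is_series_gcoef m). fold g in H.
assert (H1 : is_series (fun n => Phi (2 * m) (IZR (Z.of_nat n))) (K * gcoef m)).
{ eapply is_series_ext; [|exact (is_series_scal (V := R_NormedModule) K _ _ H)].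
  intros n. rewrite tcoef_Phi, <- INR_IZR_INZ. reflexivity. }
assert (G0 : g 0%nat = tcoef m 0) by (unfold g; simpl (INR 0); f_equal; ring).
assert (H2 : is_series (fun n => Phi (2 * m) (IZR (- Z.of_nat (S n)))) (K * (gcoef m - tcoef m 0))).
(* The negative half of a bilateral series starts at -1, so the term of index 0 is taken off. *)
{ assert (H3 : is_series (fun n => g (S n)) (gcoef m - tcoef m 0)).
  { apply (is_series_incr_1 (V := R_NormedModule)). rewrite G0.
    eapply eq_ind; [exact H|]. change (gcoef m = gcoef m - tcoef m 0 + tcoef m 0). ring. }
  eapply is_series_ext; [|exact (is_series_scal (V := R_NormedModule) K _ _ H3)].
  intros n. rewrite tcoef_Phi, opp_IZR, <- INR_IZR_INZ. unfold g. fold K.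
  replace ((- INR (S n)) ^ 2) with (INR (S n) ^ 2) by ring. reflexivity. }
unfold ZSeries. rewrite (is_series_unique _ _ H1), (is_series_unique _ _ H2).
unfold thcoef. ring.
Qed.

(** At the even index 2m the sign (-1)^(2m) disappears, and by [hbinom0_fact] the factorial term is
    twice a coefficient of (1-w)^(-1/2), that is, the coefficient of w^(2m) in (1-w)^(-1/2) +
    (1+w)^(-1/2). *)
Lemma alpha_even_thcoef m : alpha_even m = thcoef (2 * m) - 2 * hbinom 0 (2 * m).
Proof.
unfold alpha_even, S_even. rewrite ZSeries_Phi, hbinom0_fact, pow_1_even.
replace (2 * (2 * m))%nat with (4 * m)%nat by lia.
assert (E : 4 ^ (2 * m) = 2 ^ (4 * m)).
{ replace (4 * m)%nat with (2 * (2 * m))%nat by lia. rewrite (pow_mult 2 2). f_equal. ring. }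
rewrite E. field. split; [apply INR_fact_neq_0|apply pow_nonzero; lra].
Qed.

(** * Branches of the square root on the sector *)

Lemma Csquare_eq (u v : C) : (u * u = v * v)%C -> u = v \/ u = (- v)%C.
Proof.
intros H. destruct (Ceq_dec (u - v) 0) as [E|E].
- left. now apply Ceq_minus.
- right. assert (X : ((u - v) * (u + v) = 0)%C) by (transitivity (u * u - v * v)%C; [ring|rewrite H; ring]).
  destruct (Ceq_dec (u + v) 0) as [E'|E'].
  + transitivity (u + v - v)%C; [ring|rewrite E'; ring].
  + destruct (Cmult_neq_0 _ _ E E' X).
Qed.

(** On the sector both cos(theta) and cos(2 theta) = cos^2 - sin^2 are positive. The algebraic form
    gives Re (t^2) > 0, hence |w| < 1, and also decides signs in [hseries_opp]. *)
Lemma sector_Re_Im (t : C) : sector t -> Rabs (Im t) < Re t.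
Proof.
intros [r [th [Hr [Hth E]]]].
assert (H2 : 0 < cos (2 * th)) by (apply cos_gt_0; lra).
assert (H1 : 0 < cos th) by (apply cos_gt_0; lra).
rewrite cos_2a in H2.
assert (EC : Cexp (Ci * RtoC th) = (cos th, sin th)).
{ unfold Cexp. replace (Re (Ci * RtoC th)) with 0 by (simpl; ring).
  replace (Im (Ci * RtoC th)) with th by (simpl; ring). now rewrite exp_0, !Rmult_1_l. }
assert (ER : Re t = r * cos th) by now rewrite E, re_scal_l, EC.
assert (EI : Im t = r * sin th) by now rewrite E, im_scal_l, EC.
rewrite ER, EI, Rabs_mult, Rabs_right by lra.
apply Rmult_lt_compat_l; [exact Hr|]. apply Rabs_def1; nra.
Qed.

Lemma Re_sqr_pos (t : C) : Rabs (Im t) < Re t -> 0 < Re (t * t).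
Proof. intros H. rewrite Re_mult. apply Rabs_def2 in H. nra. Qed.

Lemma Cmod_cayley_inv_lt_1 (z : C) : 0 < Re z -> Cmod ((z - 1) / (z + 1)) < 1.
Proof.
intros Hz.
assert (Hn : (z + 1)%C <> 0).
{ intros E. assert (X : Re (z + 1) = 0) by now rewrite E. rewrite Re_plus, re_RtoC in X. lra. }
rewrite Cmod_div by exact Hn. assert (P := proj1 (Cmod_gt_0 _) Hn).
apply (Rmult_lt_reg_r (Cmod (z + 1))); [exact P|].
unfold Rdiv. rewrite Rmult_assoc, Rinv_l, Rmult_1_l, Rmult_1_r by lra.
destruct z as [a b]. simpl in Hz. unfold Cmod. apply sqrt_lt_1_alt. cbn [fst snd Cplus Cminus Copp RtoC].
assert (X := pow2_ge_0 (a + - (1))). assert (Y := pow2_ge_0 (b + - 0)). split; [lra|nra].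
Qed.

Lemma Csqrt_unique (z u : C) : (u * u)%C = z -> 0 < Re u -> Csqrt z = u.
Proof.
intros Hu Hr. destruct (Csquare_eq (Csqrt z) u) as [E|E]; [now rewrite Csqrt_sqr|exact E|].
exfalso. assert (P := Csqrt_principal z). rewrite E in P.
change (Re (- u)) with (- Re u) in P. lra.
Qed.

Lemma cayley_inv (z : C) : (z + 1)%C <> 0 -> cayley ((z - 1) / (z + 1)) = z.
Proof.
intros Hn. unfold cayley. field. split; [exact Hn|].
replace (z + 1 - (z - 1))%C with (RtoC 2) by ring.
intros E. apply RtoC_inj in E. lra.
Qed.

(** Both sides have the square 1/(1-w). The opposite sign is excluded because t and [hseries (- w)]
    have arguments strictly between -PI/4 and PI/4, so their product has positive real part, as
    [hseries w] has. Consequently 1/t is [hseries (- w)] divided by [hseries w]. *)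
Lemma hseries_opp (t w : C) : Rabs (Im t) < Re t -> Cmod w < 1 -> cayley w = (t * t)%C ->
  (t * hseries (- w))%C = hseries w.
Proof.
intros Ht Hw Hc. assert (Hw' : Cmod (- w) < 1) by now rewrite Cmod_opp.
assert (Hn := Cminus_1_neq_0 w Hw). assert (Hn' := Cminus_1_neq_0 _ Hw').
assert (S1 := hseries_sqr w Hw). assert (S2 := hseries_sqr _ Hw').
assert (R1 := hseries_Re_pos w Hw).
assert (I2 := hseries_Im_lt _ Hw').
set (B := hseries w) in *. set (B' := hseries (- w)) in *.
destruct (Csquare_eq (t * B') B) as [E|E]; [|exact E|].
- transitivity ((t * t) * (B' * B'))%C; [ring|]. rewrite <- Hc. unfold cayley.
  transitivity ((B' * B' * (1 - - w)) * (1 / (1 - w)))%C; [field; exact Hn|].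
  rewrite S2. rewrite <- S1 at 1. field. exact Hn.
- exfalso. assert (X : Re (t * B') = - Re B) by now rewrite E.
  rewrite Re_mult in X. apply Rabs_def2 in Ht. apply Rabs_def2 in I2. nra.
Qed.

Theorem mainTheorem1 :
  forall t : C, sector t ->
  exists theta : C,
    is_Zseries (fun n : Z => Cexp (- (RtoC PI * RtoC (IZR n) ^ 2 * t ^ 2))%C : C_NormedModule)
      theta /\
    is_series (fun m : nat => (RtoC (alpha_even m) * Psi (2 * m) t)%C : C_NormedModule)
      (theta - 1 - 1 / t)%C.
Proof.
intros t Hsec. assert (Ht := sector_Re_Im t Hsec).
set (z := (t * t)%C). assert (Hz : 0 < Re z) by now apply Re_sqr_pos.
assert (Hz2 : (t ^ 2)%C = z) by (unfold z; simpl; ring).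
assert (Hn : (z + 1)%C <> 0).
{ intros E. assert (X : Re (z + 1) = 0) by now rewrite E. rewrite Re_plus, re_RtoC in X. lra. }
assert (Ht0 : t <> 0).
{ intros E. rewrite E in Ht. assert (X := Rabs_pos (Im 0)). rewrite re_RtoC in Ht. lra. }
set (w := ((z - 1) / (z + 1))%C).
assert (Hw : Cmod w < 1) by now apply Cmod_cayley_inv_lt_1.
assert (Hc : cayley w = z) by now apply cayley_inv.
assert (HB0 := hseries_neq_0 w Hw).
assert (HBt : (t * hseries (- w))%C = hseries w) by now apply hseries_opp.
(* Since 1 + t^2 = 2/(1-w), the right side is a square root of it, and its positive real part makes
   it the principal one. The factor sqrt 2 then cancels in [Psi], leaving w^m divided by
   [hseries w]. *)
assert (Hsq : Csqrt (1 + t ^ 2) = (RtoC (sqrt 2) * hseries w)%C).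
{ assert (S2 : (RtoC (sqrt 2) * RtoC (sqrt 2))%C = RtoC 2) by (rewrite <- RtoC_mult, sqrt_sqrt; [reflexivity|lra]).
  apply Csqrt_unique.
  - rewrite Hz2. transitivity (RtoC 2 * (hseries w * hseries w))%C; [rewrite <- S2; ring|].
    assert (S1 := hseries_sqr w Hw).
    transitivity (2 * ((hseries w * hseries w) * (1 - w)) * ((z + 1) / 2))%C.
    + unfold w at 5. field. exact Hn.
    + rewrite S1. field.
  - rewrite re_scal_l. apply Rmult_lt_0_compat; [apply sqrt_lt_R0; lra|now apply hseries_Re_pos]. }
assert (HPsi : forall m, Psi m t = (w ^ m / hseries w)%C).
{ intros m. unfold Psi. rewrite Hsq, Hz2. fold w. field. split; [exact HB0|].
  intros E. apply RtoC_inj in E. assert (X := sqrt_lt_R0 2 ltac:(lra)). lra. }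
destruct (thcoef_generating w Hw) as [L [H1 H2]].
(* L sums the indices n >= 0; by symmetry the negative half is L without the term n = 0, which is
   1. *)
exists (L + (L - 1))%C. split.
- exists L, (L - 1)%C. split; [|split; [|reflexivity]].
  + eapply is_series_ext; [|exact H1]. intros n. cbv beta. f_equal.
    rewrite Hz2, Hc, <- INR_IZR_INZ, RtoC_mult, RtoC_pow. as_C; ring.
  + eapply is_series_ext; [|replace (L - 1)%C with (L - Cexp (- (RtoC (PI * INR 0 ^ 2) * cayley w)))%C; [exact (is_Cseries_incr _ _ H1)|]].
    * intros n. cbv beta. f_equal.
      rewrite Hz2, Hc, opp_IZR, <- INR_IZR_INZ, RtoC_opp, RtoC_mult, RtoC_pow. as_C; ring.
    * replace (- (RtoC (PI * INR 0 ^ 2) * cayley w))%C with (RtoC 0).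
      -- now rewrite Cexp_RtoC, exp_0.
      -- replace (PI * INR 0 ^ 2) with 0 by (simpl; ring). ring.
- assert (Hw' : Cmod (- w) < 1) by now rewrite Cmod_opp.
  assert (E1 : is_Cseries (fun m => RtoC (thcoef (2 * m)) * w ^ (2 * m))%C (hseries w * (2 * L - 1))%C).
  { apply (is_Cseries_even (fun m => RtoC (thcoef m) * w ^ m)%C); [|exact H2].
    intros m. cbv beta. rewrite thcoef_odd. apply Cmult_0_l. }
  assert (Hpar : forall m, ((- w) ^ (2 * m) = w ^ (2 * m))%C).
  { intros m. rewrite !Cpow_mult_r. f_equal. ring. }
  (* Adding the expansions at w and -w kills the odd powers and doubles the even ones. After
     division by [hseries w] the sum becomes 1 + 1/t. *)
  assert (E2 : is_Cseries (fun m => RtoC (hbinom 0 (2 * m)) * w ^ (2 * m) + RtoC (hbinom 0 (2 * m)) * (- w) ^ (2 * m))%C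
    (hseries w + hseries (- w))%C).
  { apply (is_Cseries_even (fun m => RtoC (hbinom 0 m) * w ^ m + RtoC (hbinom 0 m) * (- w) ^ m)%C).
    - intros m. change ((- w) ^ S (2 * m))%C with ((- w) * (- w) ^ (2 * m))%C.
      rewrite Hpar. change (w ^ S (2 * m))%C with (w * w ^ (2 * m))%C. as_C; ring.
    - exact (is_Cseries_plus _ _ _ _ (hseries_correct w Hw) (hseries_correct _ Hw')). }
  (* The theta value is 2L - 1; subtracting 1 + 1/t is subtracting the series [E2] from [E1] before
     the common division by [hseries w]. *)
  replace (L + (L - 1) - 1 - 1 / t)%C with
    (/ hseries w * (hseries w * (2 * L - 1) - (hseries w + hseries (- w))))%C.
  + eapply is_series_ext; [|exact (is_Cseries_scal (/ hseries w) _ _ (is_Cseries_minus _ _ _ _ E1 E2))].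
    intros m. cbv beta. rewrite alpha_even_thcoef, HPsi, Hpar, RtoC_minus, RtoC_mult. unfold Cdiv. as_C; ring.
  + replace (1 / t)%C with (hseries (- w) / hseries w)%C.
    * field. exact HB0.
    * rewrite <- HBt. field. split; [exact Ht0|]. now apply hseries_neq_0.
Qed.
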